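(* For every $\varepsilon>0$ and every positive integer $d$ there is a constant $c=c(\varepsilon,d)>0$ such that the following holds. Let $P$ be a set of $n\ge 2$ points on an irreducible algebraic curve of degree at most $d$ in the plane $\mathbb{R}^2$ that is neither a line nor a circle. Then the number of distinct distances determined by pairs of points of $P$ is at least $c\,n^{4/3-\varepsilon}$.
   Context: The number of distinct distances determined by $P$ is $|\{|ab| : a,b\in P,\ a\ne b\}|$, where $|ab|$ is the Euclidean distance. *)

(* Defs.v *)
From HB Require Import structures.
From mathcomp Require Import all_boot all_order all_algebra.
From mathcomp Require Import finmap.
From mathcomp Require Import boolp classical_sets reals exp.
From mathcomp Require Import mpoly.

Set Implicit Arguments.
Unset Strict Implicit.
Unset Printing Implicit Defensive.

Import Order.TTheory GRing.Theory Num.Theory.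
Local Open Scope ring_scope.
Local Open Scope classical_set_scope.

(* The norm provided for 'rV[R]_2 is the sup norm, hence this definition. *)
Definition edist (R : realType) (a b : 'rV[R]_2) : R :=
  Num.sqrt (\sum_(i < 2) (a 0 i - b 0 i) ^+ 2).

Definition irreducible_elt (A : idomainType) (f : A) : Prop :=
  [/\ f != 0, f \isn't a GRing.unit &
      forall g h : A, f = g * h -> g \is a GRing.unit \/ h \is a GRing.unit].

Definition zero_locus (R : realType) (f : {mpoly R[2]}) : set 'rV[R]_2 :=
  [set x | f.@[fun i => x 0 i] = 0].

(* [msize f] is 1 + the total degree of f for f != 0. Irreducibility is
   over R; degenerate (finite) real zero sets are not excluded. *)
Definition irreducible_curve_of_degree_le (R : realType) (d : nat)
    (C : set 'rV[R]_2) : Prop :=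
  exists f : {mpoly R[2]},
    [/\ irreducible_elt f, (msize f <= d.+1)%N & C = zero_locus f].

Definition is_line (R : realType) (C : set 'rV[R]_2) : Prop :=
  exists p v : 'rV[R]_2, v != 0 /\ C = [set x | exists t : R, x = p + t *: v].

Definition is_circle (R : realType) (C : set 'rV[R]_2) : Prop :=
  exists (o : 'rV[R]_2) (r : R), 0 < r /\ C = [set x | edist x o = r].

Definition distinct_distances (R : realType) (P : {fset 'rV[R]_2}) : {fset R} :=
  [fset edist ab.1 ab.2 | ab in P `*` P & ab.1 != ab.2]%fset.

(* Main.v *)
From HB Require Import structures.
Require Import Defs.
From mathcomp Require Import all_boot all_order all_algebra.
From mathcomp Require Import finmap.
From mathcomp Require Import boolp classical_sets reals exp.
From mathcomp Require Import polyXY mpoly complex zify ring lra.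
From mathcomp Require Import topology normedtype realfun derive.

Set Implicit Arguments.
Unset Strict Implicit.
Unset Printing Implicit Defensive.

Import Order.TTheory GRing.Theory Num.Theory.
Import numFieldNormedType.Exports.

(** Write N for the number of points p_1, ..., p_N and D for the number of distances. By the
    Cauchy-Schwarz inequality ([coincidences_bound]) it is enough to bound the number of
    quadruples with |p_i q_s| = |p_j q_t|, where q is a second copy of the same points: if there
    are at most T of them, then N^4 <= (D + 1) T. A quadruple is an incidence between the point
    (q_s, q_t) of an N by N grid on the surface C x C and the curve formed by the pairs (q, q')
    of points of C with |p_i q| = |p_j q'|.

    These incidences are counted by cells. Cut the plane into vertical strips holding blocks of l
    consecutive points; the products of two strips are the cells of C x C. Each of the N^2 curves
    visits only O(N / l) cells ([visited_cells_covered]), a cell contains O(l^2) grid points, and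
    two grid points lie together on boundedly many of the curves ([equidistant_covered]). Hence
    ([incidence_bound]) T = O(N^3 / l + N^2 l^2), and l close to the cube root of N gives
    T = O(N^(8/3)), that is N^4 = O(D^3).

    Visited cells. In a visited cell take the pair (q, q') for which |p_i q| = |p_j q'| is least.
    If q and q' were interior to their strips and neither was a critical point of the distance to
    its centre, both could move slightly along C towards the centres at equal distances, by the
    intermediate value theorem ([descent]). So q or q' is on a strip boundary or critical
    ([cell_witness]), and Bezout's theorem bounds the number of such pairs. Only if all points of
    C are critical for a centre does this fail, and that happens for at most one centre
    ([spin_center_covered]), which is discarded.

    Two grid points (a, a') and (b, b'). A curve through both has centres p, p' with
    |pa| = |p'a'| and |pb| = |p'b'|. The distances from p to a and b determine p' up to the
    reflection in the line a'b', so p is a zero of [linkage_poly], the product of f over the two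
    candidates for p', and Bezout's theorem applies unless f divides it. If |ab| = |a'b'|, then
    divisibility says that C is mapped to itself by an isometry that sends a to a'
    ([linkage_multiple_symmetric]). Since C is neither a line nor a circle, a point has boundedly
    many such images, and pairs (a, a') of this kind can be counted directly. If |ab| is different
    from |a'b'|, then for p close to a no real p' exists; there [linkage_poly] is a sum of two
    squares, and its expansion to second order at a shows that the isotropic line through a' is
    tangent to C at a complex point ([linkage_multiple_isotropic]), unless ab is normal to C at a.
    Boundedly many a' have such an isotropic line ([isotropic_covered]); they and the singular
    points are discarded, and chords normal to C at both ends are avoided by passing to a positive
    proportion of the points ([independent_set]). *)

(** * Finite covers and counting *)

Definition covered (T : eqType) (k : nat) (Q : T -> Prop) : Prop :=
  exists s : seq T, (size s <= k)%N /\ forall q, Q q -> q \in s.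

Lemma covered_sub (T : eqType) k l (Q Q' : T -> Prop) :
  (k <= l)%N -> (forall q, Q' q -> Q q) -> covered k Q -> covered l Q'.
Proof.
move=> kl sub [s [sk sQ]]; exists s; split; first exact: leq_trans sk kl.
by move=> q /sub; exact: sQ.
Qed.

Lemma covered_or (T : eqType) k l (Q Q' : T -> Prop) :
  covered k Q -> covered l Q' -> covered (k + l) (fun q => Q q \/ Q' q).
Proof.
move=> [s [sk sQ]] [t [tl tQ]]; exists (s ++ t); split.
  by rewrite size_cat leq_add.
by move=> q [/sQ|/tQ] h; rewrite mem_cat h ?orbT.
Qed.

Lemma covered_pair (T U : eqType) k l (Q : T -> Prop) (Q' : T -> U -> Prop) :
  covered k Q -> (forall x, Q x -> covered l (Q' x)) ->
  covered (k * l) (fun z : T * U => Q z.1 /\ Q' z.1 z.2).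
Proof.
move=> [s [sk sQ]] cov.
have /choice [F FP] : forall x, exists t : seq U, (size t <= l)%N /\
    (Q x -> forall y, Q' x y -> y \in t).
  move=> x; have [/cov [t [tl tQ]]|nQ] := pselect (Q x); first by exists t.
  by exists [::].
exists [seq (x, y) | x <- s, y <- F x]; split.
  rewrite size_allpairs_dep (leq_trans _ (leq_mul sk (leqnn l))) //.
  elim: s {sk sQ} => //= x s IHs; rewrite mulSn leq_add //; by case: (FP x).
case=> x y /= [Qx Qy]; apply/allpairsPdep; exists x, y; split=> //; first exact: sQ.
by case: (FP x) => _; apply.
Qed.

Lemma covered_image (T U : eqType) k (Q : T -> Prop) (h : T -> U) :
  covered k Q -> covered k (fun y => exists2 x, Q x & h x = y).
Proof.
move=> [s [sk sQ]]; exists (map h s); rewrite size_map; split=> // y [x Qx <-].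
by apply: map_f; exact: sQ.
Qed.

Lemma covered_functional (T U : eqType) k (Q : T -> Prop) (rel : T -> U -> Prop) :
  (forall x y y', rel x y -> rel x y' -> y = y') ->
  covered k Q -> covered k (fun y => exists2 x, Q x & rel x y).
Proof.
move=> fun_rel cov.
have cov1 x : Q x -> covered 1 (rel x).
  move=> _; have [[y xy]|none] := pselect (exists y, rel x y).
    by exists [:: y]; split=> // y' xy'; rewrite inE; apply/eqP; exact: fun_rel xy' xy.
  by exists [::]; split=> // y xy; case: none; exists y.
have := covered_image snd (covered_pair cov cov1); rewrite muln1.
by apply: covered_sub => // y [x Qx xy]; exists (x, y).
Qed.

Lemma card_covered (T : finType) (U : eqType) k (h : T -> U) (Q : U -> Prop) (A : {set T}) :
  {in A &, injective h} -> (forall x, x \in A -> Q (h x)) -> covered k Q -> (#|A| <= k)%N.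
Proof.
move=> injh AQ [s [sk sQ]]; apply: leq_trans sk; rewrite cardE -(size_map h).
apply: uniq_leq_size.
  rewrite map_inj_in_uniq ?enum_uniq // => x y; rewrite !mem_enum; exact: injh.
by move=> _ /mapP[x + ->]; rewrite mem_enum => /AQ /sQ.
Qed.

Lemma card_fibers (T U : finType) (g : T -> U) (A : {set T}) k :
  (forall u, (#|[set x in A | g x == u]| <= k)%N) -> (#|A| <= #|g @: A| * k)%N.
Proof.
move=> fib; rewrite -sum1_card (partition_big_imset g) /= -sum_nat_const.
apply: leq_sum => u _; rewrite sum1_card; apply: leq_trans (fib u).
by apply/eq_leq/eq_card => x; rewrite !inE.
Qed.

(** If i has x incidences in one cell, then x <= 1 + x (x - 1): every incidence but one per
    visited cell is charged to an ordered pair of incidences of i in the same cell. There are at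
    most #|W| * L pairs of points sharing a cell, and each is charged by at most M of the i. *)
Lemma incidence_bound (I W B : finType) (inc : I -> W -> bool) (beta : W -> B) V M L :
  (forall i, (#|beta @: [set w | inc i w]| <= V)%N) ->
  (forall w w', w != w' -> (#|[set i | inc i w && inc i w']| <= M)%N) ->
  (forall w, (#|[set w' | beta w' == beta w]| <= L)%N) ->
  (\sum_i #|[set w | inc i w]| <= #|I| * V + #|W| * L * M)%N.
Proof.
move=> hV hM hL.
pose pairs i := [set z : W * W | [&& inc i z.1, inc i z.2, z.1 != z.2 & beta z.1 == beta z.2]].
have one i : (#|[set w | inc i w]| <= V + #|pairs i|)%N.
  pose S := [set w | inc i w].
  pose rep w := odflt w [pick w' in S | beta w' == beta w].
  have repP w : w \in S -> (rep w \in S) && (beta (rep w) == beta w).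
    move=> wS; rewrite /rep; case: pickP => [w' //|/(_ w)]; by rewrite wS eqxx.
  have rep_eq w w' : w \in S -> beta w = beta w' -> w' \in S -> rep w = rep w'.
    move=> wS E w'S; rewrite /rep; under eq_pick do rewrite E.
    by case: pickP => // /(_ w'); rewrite w'S eqxx.
  rewrite -/S -(cardsID [set w | rep w == w] S); apply: leq_add.
    apply: leq_trans (hV i); rewrite -(card_in_imset (f := beta)); last first.
      move=> w w'; rewrite !inE => /andP[wS /eqP rw] /andP[w'S /eqP rw'] E.
      by rewrite -rw -rw' (rep_eq w w') // inE.
    by apply: subset_leq_card; apply: finset.imsetS; apply: finset.subsetIl.
  rewrite -(card_in_imset (f := fun w => (rep w, w))); last by move=> w w' _ _ [].
  apply: subset_leq_card; apply/fintype.subsetP => _ /imsetP[w + ->]; rewrite !inE => /andP[rw wS].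
  have /repP : w \in S by rewrite inE.
  by rewrite inE rw wS /= => /andP[-> ->].
apply: (@leq_trans (\sum_i (V + #|pairs i|))); first exact: leq_sum.
rewrite big_split /= sum_nat_const leq_add2l.
have -> : (\sum_i #|pairs i| = \sum_(z : W * W | (z.1 != z.2) && (beta z.1 == beta z.2))
    #|[set i | inc i z.1 && inc i z.2]|)%N.
  under eq_bigr do rewrite -sum1dep_card.
  under [RHS]eq_bigr do rewrite -sum1dep_card.
  rewrite (exchange_big_dep (fun z : W * W => (z.1 != z.2) && (beta z.1 == beta z.2))) /=.
    apply: eq_bigr => z /andP[zne zb]; apply: eq_bigl => i.
    by rewrite zne zb !andbT.
  by move=> i z _ /and4P[_ _ -> ->].
apply: (@leq_trans (\sum_(z : W * W | (z.1 != z.2) && (beta z.1 == beta z.2)) M)).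
  by apply: leq_sum => z /andP[zne _]; exact: hM.
rewrite sum_nat_const leq_mul2r; apply/orP; right.
apply: (@leq_trans #|[set z : W * W | beta z.2 == beta z.1]|).
  by apply: subset_leq_card; apply/fintype.subsetP => z; rewrite !inE => /andP[_ /eqP ->].
rewrite -sum1dep_card -(pair_big_dep xpredT (fun w w' => beta w' == beta w) (fun _ _ => 1%N)) /=.
rewrite -sum_nat_const; apply: leq_sum => w _.
by rewrite sum1dep_card.
Qed.

(** An independent set of maximal size dominates A: each of its elements, together with its
    neighbours, accounts for at most k + 1 elements of A. *)
Lemma independent_set (T : finType) (e : rel T) (A : {set T}) k :
  ssrbool.symmetric e -> irreflexive e -> (forall x, x \in A -> (#|[set y in A | e x y]| <= k)%N) ->
  exists S : {set T}, [/\ S \subset A, {in S &, forall x y, ~~ e x y} & (#|A| <= #|S| * k.+1)%N].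
Proof.
move=> sym irr deg.
pose indep (S : {set T}) := (S \subset A) && [forall x in S, forall y in S, ~~ e x y].
have indep0 : indep finset.set0.
  by rewrite /indep finset.sub0set; apply/forall_inP => x; rewrite inE.
have [S /andP[SA Sind] Smax] := arg_maxnP (fun S : {set T} => #|S|) indep0.
have SP : {in S &, forall x y, ~~ e x y}.
  by move=> x y xS yS; have /forall_inP/(_ x xS)/forall_inP := Sind; apply.
exists S; split=> //.
have cov : A \subset \bigcup_(x in S) (x |: [set y in A | e x y]).
  apply/fintype.subsetP => y yA; apply/bigcupP.
  have [yS|yS] := boolP (y \in S); first by exists y; rewrite // !inE eqxx.
  have [[x xS exy]|none] := pselect (exists2 x, x \in S & e x y).
    by exists x => //; rewrite !inE yA exy orbT.
  have : indep (y |: S).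
    rewrite /indep finset.subUset finset.sub1set yA SA /=; apply/forall_inP => u uS; apply/forall_inP => v.
    move: uS; rewrite !inE => /orP[/eqP ->|uS] /orP[/eqP ->|vS].
    - by rewrite irr.
    - by apply/negP => eyv; apply: none; exists v; rewrite // sym.
    - by apply/negP => euy; apply: none; exists u.
    - exact: SP.
  by move/Smax; rewrite cardsU1 yS add1n /= ltnn.
apply: (leq_trans (subset_leq_card cov)).
apply: (@leq_trans (\sum_(x in S) #|x |: [set y in A | e x y]|)).
  elim/big_rec2: _ => [|x m X _ le]; first by rewrite cards0.
  by apply: leq_trans (leq_card_setU _ _) _; rewrite leq_add2l.
rewrite -sum_nat_const; apply: leq_sum => x xS.
apply: leq_trans (leq_card_setU _ _) _; rewrite cards1 add1n ltnS.
by apply: deg; exact: (fintype.subsetP SA).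
Qed.

(** Cauchy-Schwarz for the sizes of the fibres of F. *)
Lemma coincidences_bound (X : finType) (Y : eqType) (F : X -> Y) (values : seq Y) :
  (forall x, F x \in values) ->
  (#|X| ^ 2 <= size values * #|[set z : X * X | F z.1 == F z.2]|)%N.
Proof.
move=> Fv; pose vs := undup values.
pose c (v : Y) := #|[set x | F x == v]|.
have sumc : (#|X| = \sum_(v <- vs) c v)%N.
  rewrite -sum1_card -(eq_bigr _ (fun v _ => sum1dep_card _)).
  rewrite (exchange_big_dep xpredT) //=; apply: eq_bigr => x _.
  rewrite -big_filter (eq_filter (a2 := pred1 (F x))); last by move=> v; rewrite /= eq_sym.
  by rewrite filter_pred1_uniq ?undup_uniq ?mem_undup ?Fv // big_seq1.
have sumc2 : (#|[set z : X * X | F z.1 == F z.2]| = \sum_(v <- vs) c v ^ 2)%N.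
  rewrite -sum1dep_card.
  have -> : (\sum_(v <- vs) c v ^ 2 = \sum_(v <- vs) \sum_(z : X * X | (F z.1 == v) && (F z.2 == v)) 1)%N.
    apply: eq_bigr => v _; rewrite sum1dep_card -mulnn -cardsX.
    by apply: eq_card => -[x y]; rewrite !inE.
  rewrite (exchange_big_dep (fun z : X * X => F z.1 == F z.2)) /=; last first.
    by move=> v z _ /andP[/eqP -> /eqP ->].
  apply: eq_bigr => z /eqP zE.
  rewrite -big_filter (eq_filter (a2 := pred1 (F z.1))).
    by rewrite filter_pred1_uniq ?undup_uniq ?mem_undup ?Fv // big_seq1.
  by move=> v; rewrite /= zE andbb eq_sym.
apply: (@leq_trans (size vs * \sum_(v <- vs) c v ^ 2)); last first.
  by rewrite sumc2 leq_mul2r size_undup orbT.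
rewrite -(leq_pmul2l (ltn0Sn 1)) sumc -mulnn big_distrlr /= big_distrr /=.
apply: (@leq_trans (\sum_(u <- vs) \sum_(v <- vs) (c u ^ 2 + c v ^ 2))).
  apply: leq_sum => u _; rewrite big_distrr /=; apply: leq_sum => v _.
  by rewrite -!mulnn; exact: nat_Cauchy.
under eq_bigr do rewrite big_split /= big_const_seq count_predT iter_addn_0.
rewrite big_split /= big_const_seq count_predT iter_addn_0 -big_distrl /=.
by rewrite addnn -mul2n [(size vs * _)%N]mulnC.
Qed.

(** Blocks of l consecutive values, with their closed hulls: t belongs to the block numbered by the
    rank of X t divided by l. Distinct hulls are disjoint since this number is monotone in X t. *)
Lemma strips (R : realDomainType) (T : finType) (X : T -> R) (l k : nat) :
  (0 < l)%N -> (forall v, (#|[set t | X t == v]| <= k)%N) ->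
  let r := (#|T| %/ l).+1 in
  exists (beta : T -> 'I_r) (lo hi : 'I_r -> R),
  [/\ forall t, (lo (beta t) <= X t <= hi (beta t))%R,
      forall i j x, (lo i <= x <= hi i)%R -> (lo j <= x <= hi j)%R -> i = j &
      forall t, (#|[set t' | beta t' == beta t]| <= l * k)%N].
Proof.
move=> l0 mult r; pose vals := undup (map X (enum T)).
pose rk t := count (fun v => (v < X t)%R) vals.
have in_vals t : X t \in vals by rewrite mem_undup map_f // mem_enum.
have rk_mono t t' : (X t <= X t')%R -> (rk t <= rk t')%N.
  by move=> le; apply: sub_count => v /= /lt_le_trans; apply.
have rk_strict t t' : (X t < X t')%R -> (rk t < rk t')%N.
  move=> lt; rewrite -addn1.
  have h1 : (0 < count (pred1 (X t)) vals)%N.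
    by rewrite -has_count; apply/hasP; exists (X t); rewrite //= eqxx.
  apply: (leq_trans (leq_add (leqnn _) h1)); rewrite -count_predUI.
  rewrite [X in (_ + X <= _)%N](eq_count (a2 := pred0)); last first.
    by move=> v; rewrite /=; case: eqP => [->|]; rewrite ?ltxx ?andbF.
  rewrite count_pred0 addn0; apply: sub_count => v /= /orP[/lt_trans|/eqP ->]; first by apply.
  exact: lt.
have rk_le t t' : (rk t <= rk t')%N = (X t <= X t')%R.
  apply/idP/idP; last exact: rk_mono.
  by apply: contraTT; rewrite -ltNge -ltnNge; exact: rk_strict.
have rk_eq t t' : rk t = rk t' -> X t = X t'.
  by move=> E; apply: le_anti; rewrite -!rk_le E leqnn.
have rk_lt t : (rk t < #|T|)%N.
  have szv : (size vals <= #|T|)%N by rewrite (leq_trans (size_undup _)) // size_map -cardT.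
  apply: leq_trans szv; rewrite ltn_neqAle count_size andbT -all_count.
  by apply/negP => /allP /(_ _ (in_vals t)); rewrite /= ltxx.
have b_lt t : (rk t %/ l < r)%N by rewrite ltnS leq_div2r // ltnW.
pose beta t : 'I_r := Ordinal (b_lt t).
have beta_mono t t' : (X t <= X t')%R -> (beta t <= beta t')%N.
  by move=> /rk_mono le; rewrite /= leq_div2r.
have hull i : exists lh : R * R,
    (forall t, beta t = i -> (lh.1 <= X t <= lh.2)%R) /\
    (forall x, (lh.1 <= x <= lh.2)%R -> exists t t', [/\ beta t = i, beta t' = i & (X t <= x <= X t')%R]).
  have [[t0 t0i]|none] := pselect (exists t, beta t = i); last first.
    (* An empty block gets the empty interval. *)
    exists (1, 0)%R; split=> [t ti|x /= /andP[x1 x0]]; first by case: none; exists t.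
    by have := le_trans x1 x0; rewrite ler10.
  have t0i' : beta t0 == i by apply/eqP.
  case: (@Order.TotalTheory.arg_minP _ _ _ t0 (fun t => beta t == i) X t0i') => tm /eqP tmi tmP.
  case: (@Order.TotalTheory.arg_maxP _ _ _ t0 (fun t => beta t == i) X t0i') => tM /eqP tMi tMP.
  exists (X tm, X tM); split=> [t /eqP ti|x xP] /=.
    by apply/andP; split; [exact: tmP | exact: tMP].
  by exists tm, tM.
have [lh lhP] := choice hull.
exists beta, (fun i => (lh i).1), (fun i => (lh i).2); split=> [t|i j x xi xj|t].
- by case: (lhP (beta t)) => h _; apply: h.
- have half i' j' : (exists t t', [/\ beta t = i', beta t' = i' & (X t <= x <= X t')%R]) ->
     (exists t t', [/\ beta t = j', beta t' = j' & (X t <= x <= X t')%R]) -> (i' <= j')%N.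
    move=> [t [_ [<- _ /andP[tx _]]]] [_ [t' [_ <- /andP[_ xt']]]].
    by apply: beta_mono; exact: le_trans tx xt'.
  have [_ hi] := lhP i; have [_ hj] := lhP j.
  by apply/val_inj/anti_leq/andP; split; apply: half; [exact: hi|exact: hj|exact: hj|exact: hi].
- have lts t' : (rk t' %% l < l)%N by rewrite ltn_mod.
  pose g t' : 'I_l := Ordinal (lts t').
  apply: leq_trans (card_fibers (g := g) (k := k) _) _; last first.
    by rewrite leq_mul2r (leq_trans (max_card _)) ?card_ord ?orbT.
  move=> u; have [E|] := eqVneq [set x in [set t' | beta t' == beta t] | g x == u] finset.set0.
    by rewrite E cards0.
  move=> /finset.set0Pn[t1]; rewrite !inE => /andP[/eqP b1 /eqP g1].
  apply: leq_trans (mult (X t1)); apply: subset_leq_card; apply/fintype.subsetP => t2.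
  rewrite !inE => /andP[/eqP b2 /eqP g2]; apply/eqP/rk_eq.
  rewrite (divn_eq (rk t2) l) (divn_eq (rk t1) l).
  have := congr1 val b1; have := congr1 val b2; have := congr1 val g1; have := congr1 val g2.
  by rewrite /= => -> -> -> ->.
Qed.

Lemma card_pairs_le (T U : finType) (P : T -> U -> bool) k :
  (forall x, (#|[set y | P x y]| <= k)%N) ->
  (#|[set z : T * U | P z.1 z.2]| <= #|T| * k)%N.
Proof.
move=> h; rewrite -sum1dep_card -(pair_big_dep xpredT P (fun _ _ => 1%N)) /=.
by rewrite -sum_nat_const; apply: leq_sum => x _; rewrite sum1dep_card.
Qed.

Lemma exchange_count (I W : finType) (P : I -> W -> bool) (Q : pred W) :
  (\sum_i #|[set w | P i w && Q w]| = \sum_(w | Q w) #|[set i | P i w]|)%N.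
Proof.
transitivity (\sum_i \sum_(w | P i w && Q w) 1)%N.
  by apply: eq_bigr => i _; rewrite sum1dep_card.
rewrite (exchange_big_dep Q) /=; last by move=> i w _ /andP[].
apply: eq_bigr => w Qw; rewrite -sum1dep_card.
by apply: eq_bigl => i; rewrite Qw andbT.
Qed.

Lemma cube_root_floor n : exists l, (l ^ 3 <= n < l.+1 ^ 3)%N.
Proof.
have ex : exists l, (l ^ 3 <= n)%N by exists 0%N.
have bnd l : (l ^ 3 <= n -> l <= n)%N.
  by apply: leq_trans; case: l => // l; rewrite -{1}[l.+1]expn1 leq_pexp2l.
case: (ex_maxnP ex bnd) => l ln lmax; exists l; rewrite ln ltnNge.
by apply/negP => /lmax; rewrite ltnn.
Qed.

(** Divided by N^2, the hypothesis is N^2 <= m S with S = O(N / l + l^2). For l the integer part of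
    the cube root of N both terms of S are O(l^2), so N^6 = O(m^3 l^6), and l^6 <= N^2. *)
Lemma balance K N m l : (0 < K)%N -> (0 < N)%N -> (l ^ 3 <= N < l.+1 ^ 3)%N ->
  let r := (N %/ l).+1 in
  (N ^ 2 * N ^ 2 <= m * (N ^ 2 * (2 * (K * K)) + (N ^ 2 * (4 * r * (K * K) + 2 * (K * K))
     + N ^ 2 * (l * K) ^ 2 * (K * K))))%N ->
  (N ^ 4 <= (37 * K ^ 4) ^ 3 * m ^ 3)%N.
Proof.
move=> K0 N0 /andP[lN Nl] r.
have l0 : (0 < l)%N by case: (l) Nl => //; rewrite exp1n; lia.
have r_le : (r <= 8 * l ^ 2)%N.
  rewrite /r ltn_divLR //; apply: (leq_trans Nl).
  have -> : (8 * l ^ 2 * l = (2 * l) ^ 3)%N by rewrite expnMn -mulnA -expnSr.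
  by rewrite leq_exp2r //; lia.
set S := (2 * (K * K) + (4 * (r * (K * K)) + 2 * (K * K) + (l * K) ^ 2 * (K * K)))%N.
rewrite (_ : (m * _)%N = (N ^ 2 * (m * S))%N); last by rewrite /S; ring.
rewrite leq_pmul2l ?expn_gt0 ?N0 // => h.
have h2 : (N ^ 2 <= 37 * K ^ 4 * m * l ^ 2)%N.
  apply: (leq_trans h); rewrite /S; clear h S.
  have K2 : (K * K <= K ^ 4)%N by rewrite mulnn leq_pexp2l.
  have l2 : (0 < l ^ 2)%N by rewrite expn_gt0 l0.
  have -> : ((l * K) ^ 2 * (K * K) = l ^ 2 * K ^ 4)%N by rewrite expnMn; ring.
  have : (2 * (K * K) + (4 * (r * (K * K)) + 2 * (K * K) + l ^ 2 * K ^ 4) <= 37 * K ^ 4 * l ^ 2)%N.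
    move: (K * K)%N (K ^ 4)%N (l ^ 2)%N r K2 l2 r_le => a b c e ab c0 ec.
    have h3 : (a <= b * c)%N by rewrite (leq_trans ab) // leq_pmulr.
    have h4 : (e * a <= 8 * (b * c))%N by rewrite (leq_trans (leq_mul ec ab)) //; apply: eq_leq; ring.
    by lia.
  by move=> h3; rewrite (leq_trans (leq_mul (leqnn m) h3)) //; apply: eq_leq; ring.
have h3 : (N ^ 2 * N ^ 4 <= N ^ 2 * ((37 * K ^ 4) ^ 3 * m ^ 3))%N.
  rewrite -expnD; apply: (@leq_trans ((37 * K ^ 4 * m * l ^ 2) ^ 3)).
    by rewrite -[(2 + 4)%N]/(2 * 3)%N expnM leq_exp2r.
  have -> : ((37 * K ^ 4 * m * l ^ 2) ^ 3 = (l ^ 3) ^ 2 * ((37 * K ^ 4) ^ 3 * m ^ 3))%N.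
    by ring.
  by rewrite leq_mul2r leq_exp2r ?lN ?orbT.
by move: h3; rewrite leq_pmul2l // expn_gt0 N0.
Qed.

Local Open Scope ring_scope.

(** * Gauss's lemma for bivariate polynomials *)

Section Gauss.
Variable F : fieldType.
Implicit Types (c p : {poly F}) (a b f g : {poly {poly F}}).

Lemma irreducible_factor c :
  (1 < size c)%N -> exists p q, irreducible_poly p /\ c = p * q.
Proof.
have [n] := ubnP (size c); elim: n => // n IHn in c * => lt_cn c_gt1.
have [[d [dc d_gt1 lt_dc]] | nd] := pselect (exists d : {poly F},
    [/\ d %| c, (1 < size d)%N & (size d < size c)%N]).
  have [|//|p [q [irr_p dE]]] := IHn d; first exact: leq_trans lt_dc _.
  have /dvdpP[e ->] := dc.
  by exists p, (e * q); rewrite dE mulrCA.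
exists c, 1; rewrite mulr1; split=> //; split=> // q q_neq1 qc.
have c_neq0 : c != 0 by rewrite -size_poly_gt0 (leq_trans _ c_gt1).
have q_neq0 : q != 0 by apply: contra_neq c_neq0 => q0; apply/eqP; rewrite q0 dvd0p in qc.
have q_gt1 : (1 < size q)%N.
  by rewrite ltn_neqAle eq_sym q_neq1 size_poly_gt0.
rewrite -dvdp_size_eqp // eqn_leq dvdp_leq //= leqNgt; apply/negP => lt_qc.
by apply: nd; exists q.
Qed.

Lemma dvd_polyC p a :
  (forall i, p %| a`_i) -> exists a', a = p%:P * a'.
Proof.
move=> pa; exists (\poly_(i < size a) (a`_i %/ p)).
apply/polyP => i; rewrite coefCM coef_poly.
case: ltnP => [_|le_ai]; last by rewrite mulr0 nth_default.
by rewrite mulrC divpK.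
Qed.

(** Gauss's lemma: if p divides neither a nor b, take the lowest coefficients of a and b that p
    does not divide, at i and j; then p does not divide the coefficient of a * b at i + j. *)
Lemma irreducible_polyC_dvdM p a b g : irreducible_poly p -> p%:P * g = a * b ->
  (exists a', a = p%:P * a') \/ (exists b', b = p%:P * b').
Proof.
move=> irr_p gE.
have [pa|] := pselect (forall i, p %| a`_i); first by left; exact: dvd_polyC.
have [pb|] := pselect (forall i, p %| b`_i); first by right; exact: dvd_polyC.
move=> /existsNP[j0 /negP jb] /existsNP[i0 /negP ia].
have exb : exists j, ~~ (p %| b`_j) by exists j0.
have exa : exists i, ~~ (p %| a`_i) by exists i0.
case: (ex_minnP exa) => i pai mini; case: (ex_minnP exb) => j pbj minj.
have : p %| (a * b)`_(i + j) by rewrite -gE coefCM dvdp_mulr.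
have lt_i : (i < (i + j).+1)%N by rewrite ltnS leq_addr.
rewrite coefM (bigD1 (Ordinal lt_i)) //= addKn dvdp_addl; last first.
  elim/big_ind: _ => [|x y px py|k ki]; [exact: dvdp0|exact: dvdp_add|].
  have [lt_ki|le_ik] := ltnP k i.
    apply: dvdp_mulr; apply: contraLR lt_ki => /mini.
    by rewrite -leqNgt.
  have lt_ik : (i < k)%N by rewrite ltn_neqAle le_ik andbT eq_sym.
  apply: dvdp_mull; have : (i + j - k < j)%N by have := ltn_ord k; lia.
  by apply: contraLR => /minj; rewrite -leqNgt.
have cop q : ~~ (p %| q) -> coprimep p q.
  move=> npq; rewrite /coprimep; apply: contraNT npq => /(irr_p _) /(_ (dvdp_gcdl _ _)).
  by move=> /eqp_dvdl <-; exact: dvdp_gcdr.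
by rewrite Gauss_dvdpl ?cop // (negPf pai).
Qed.

(** The irreducible factors of c are removed one by one, each from a or from b. *)
Lemma Gauss_factor c f a b : c != 0 -> c%:P * f = a * b ->
  exists a' b', [/\ f = a' * b', size a' = size a & size b' = size b].
Proof.
have [n] := ubnP (size c); elim: n => // n IHn in c a b * => lt_cn c_neq0 fE.
have [c_le1|c_gt1] := leqP (size c) 1.
  have [u u_neq0 cE] : exists2 u, u != 0 & c = u%:P.
    have cE := size1_polyC c_le1; exists c`_0 => //.
    by apply: contra_neq c_neq0 => c00; rewrite cE c00.
  exists ((u^-1)%:P%:P * a), b; split=> //.
    by rewrite -mulrA -fE cE mulrA -!polyCM mulVf // mul1r.
  by rewrite mul_polyC size_scale // polyC_eq0 invr_eq0.
have [p [q [irr_p cE]]] := irreducible_factor c_gt1.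
have p_neq0 := irredp_neq0 irr_p.
have q_neq0 : q != 0 by apply: contra_neq c_neq0 => q0; rewrite cE q0 mulr0.
have lt_qn : (size q < n)%N.
  move: lt_cn; rewrite cE size_mul //.
  by case: (size p) irr_p.1 => [|[|k]] // _; rewrite !addSn /= ltnS; apply: leq_trans; rewrite ltnS leq_addl.
have pP_neq0 : p%:P != 0 by rewrite polyC_eq0.
have fE' : p%:P * (q%:P * f) = a * b by rewrite mulrA -polyCM -cE.
have [[a' aE]|[b' bE]] := irreducible_polyC_dvdM irr_p fE'.
  have /(IHn _ _ _ lt_qn q_neq0) : q%:P * f = a' * b.
    by apply: (mulfI pP_neq0); rewrite fE' aE mulrA.
  by case=> x [y [fxy sx sy]]; exists x, y; split=> //; rewrite sx aE mul_polyC size_scale.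
have /(IHn _ _ _ lt_qn q_neq0) : q%:P * f = a * b'.
  by apply: (mulfI pP_neq0); rewrite fE' bE mulrCA.
by case=> x [y [fxy sx sy]]; exists x, y; split=> //; rewrite sy bE mul_polyC size_scale.
Qed.

(** An irreducible factor of c that did not divide k would divide f, which is irreducible of
    positive degree in the outer variable. *)
Lemma irreducible_dvd_cancel c f g k :
  irreducible_elt f -> (1 < size f)%N -> c != 0 -> c%:P * g = k * f ->
  exists k', g = k' * f.
Proof.
move=> irr_f f_gt1.
have [n] := ubnP (size c); elim: n => // n IHn in c k * => lt_cn c_neq0 gE.
have [c_le1|c_gt1] := leqP (size c) 1.
  have [u u_neq0 cE] : exists2 u, u != 0 & c = u%:P.
    have cE := size1_polyC c_le1; exists c`_0 => //.
    by apply: contra_neq c_neq0 => c00; rewrite cE c00.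
  exists ((u^-1)%:P%:P * k).
  by rewrite -mulrA -gE cE mulrA -!polyCM mulVf // mul1r.
have [p [q [irr_p cE]]] := irreducible_factor c_gt1.
have p_neq0 := irredp_neq0 irr_p.
have q_neq0 : q != 0 by apply: contra_neq c_neq0 => q0; rewrite cE q0 mulr0.
have lt_qn : (size q < n)%N.
  move: lt_cn; rewrite cE size_mul //.
  by case: (size p) irr_p.1 => [|[|m]] // _; rewrite !addSn /= ltnS; apply: leq_trans; rewrite ltnS leq_addl.
have pP_neq0 : p%:P != 0 by rewrite polyC_eq0.
have gE' : p%:P * (q%:P * g) = k * f by rewrite mulrA -polyCM -cE.
have [[k' kE]|[f' fE]] := irreducible_polyC_dvdM irr_p gE'.
  apply: (IHn _ k' lt_qn q_neq0).
  by apply: (mulfI pP_neq0); rewrite gE' kE mulrA.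
case: irr_f => _ _ /(_ _ _ fE) [].
  by rewrite poly_unitE coefC eqxx poly_unitE => /and3P[_ /eqP sp _]; have := irr_p.1; rewrite sp.
rewrite poly_unitE => /andP[/eqP sf' _]; move: f_gt1.
by rewrite fE mul_polyC size_scale // sf'.
Qed.

(** A common factor over the field of fractions of F[Y] gives one over F[Y] by Gauss's lemma, and
    the irreducible f has no proper factor of positive degree. *)
Lemma irreducible_dvd_gcdp f g :
  irreducible_elt f -> (1 < size f)%N -> (1 < size (gcdp f g))%N ->
  exists k, g = k * f.
Proof.
move=> irr_f f_gt1 d_gt1.
have /Pdiv.Idomain.dvdpP[[c e] /= c_neq0 fE] := dvdp_gcdl f g.
have /Pdiv.Idomain.dvdpP[[c' k] /= c'_neq0 gE] := dvdp_gcdr f g.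
rewrite -mul_polyC in fE; rewrite -mul_polyC in gE.
have [e' [d' [fE' se' sd']]] := Gauss_factor c_neq0 fE.
have e1 : size e = 1%N.
  case: irr_f => _ _ /(_ _ _ fE') [].
    by rewrite poly_unitE se' => /andP[/eqP].
  by rewrite poly_unitE sd' => /andP[/eqP sd]; move: d_gt1; rewrite sd.
have eE := size1_polyC (eq_leq e1).
have e0 : e`_0 != 0.
  by apply/eqP => e00; move: e1; rewrite eE e00 size_poly0.
apply: (@irreducible_dvd_cancel (c' * e`_0) _ _ (k * c%:P)) => //.
  by rewrite mulf_neq0.
by rewrite -mulrA fE polyCM mulrAC gE eE coefC eqxx; ring.
Qed.

End Gauss.

(** * Elimination and common zeros *)

(** Degrees are measured in each variable separately. *)
Definition bideg_le (A : nzRingType) (k : nat) (p : {poly {poly A}}) : bool :=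
  (size p <= k.+1)%N && (sizeY p <= k.+1)%N.

Lemma bideg_le_swap (A : nzRingType) k (p : {poly {poly A}}) :
  bideg_le k (swapXY p) = bideg_le k p.
Proof. by rewrite /bideg_le !sizeYE swapXYK andbC. Qed.

Lemma size_det_poly (A : idomainType) n s (M : 'M[{poly A}]_n) :
  (forall i j, (size (M i j) <= s.+1)%N) -> (size (\det M) <= (n * s).+1)%N.
Proof.
move=> sM; rewrite /determinant; apply: (leq_trans (size_sum _ _ _)).
apply/bigmax_leqP => /= t _; rewrite size_Msign.
apply: (leq_trans (size_poly_prod_leq _ _)); rewrite leq_subLR.
apply: (@leq_trans (\sum_(i < n) s.+1).+1).
  by rewrite ltnS; apply: leq_sum => i _; apply: sM.
by rewrite sum_nat_const card_ord; apply: eq_leq; lia.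
Qed.

Lemma size_resultant (A : idomainType) k e (f g : {poly {poly A}}) :
  bideg_le k f -> bideg_le e g ->
  (size (resultant f g) <= ((k + e) ^ 2).+1)%N.
Proof.
move=> /andP[fk fk'] /andP[ge ge'].
apply: (@leq_trans (((size g).-1 + (size f).-1) * (k + e)).+1); last first.
  rewrite ltnS -mulnn leq_mul2r; apply/orP; right; rewrite [X in (X <= _)%N]addnC; apply: leq_add.
    by case: (size f) fk.
  by case: (size g) ge.
apply: size_det_poly => i j; rewrite Sylvester_mxE.
have coef_bound (p : {poly {poly A}}) m l (b : bool) : (sizeY p <= m.+1)%N -> (m <= k + e)%N ->
    (size (p`_l *+ b)%R <= (k + e).+1)%N.
  move=> pm mk; case: b; rewrite ?mulr0n ?size_poly0 // mulr1n.
  by rewrite (leq_trans (max_size_coefXY _ _)) // (leq_trans pm).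
by case: (split i) => l; apply: coef_bound; eauto; rewrite ?leq_addr ?leq_addl.
Qed.

Section Elimination.
Variable F : fieldType.
Implicit Types (f g : {poly {poly F}}).

(** The resultant in the outer variable, unless f or g is already constant in it. *)
Lemma eliminate_outer k e f g :
  irreducible_elt f -> bideg_le k f -> bideg_le e g ->
  ~ (exists q, g = q * f) ->
  exists h : {poly F}, [/\ h != 0, (size h <= ((k + e) ^ 2).+1)%N &
    exists u v, h%:P = u * f + v * g].
Proof.
move=> irr_f bf bg ndiv; have [f_neq0 _ _] := irr_f.
have g_neq0 : g != 0.
  by apply/eqP => g0; apply: ndiv; exists 0; rewrite mul0r.
have le_sq m : (m <= k + e)%N -> (m.+1 <= ((k + e) ^ 2).+1)%N.
  rewrite ltnS -mulnn; case: (k + e)%N => [|n]; first by rewrite leqn0 => /eqP ->.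
  by move=> /leq_trans; apply; rewrite leq_pmull.
have const (p : {poly {poly F}}) m : p != 0 -> bideg_le m p -> (m <= k + e)%N ->
    (size p <= 1)%N -> p = (p`_0)%:P /\
    p`_0 != 0 /\ (size (p`_0)%R <= ((k + e) ^ 2).+1)%N.
  move=> p_neq0 /andP[_ pm] mk /size1_polyC pE; split=> //; split.
    by apply: contra_neq p_neq0 => p0; rewrite pE p0.
  rewrite (leq_trans (max_size_coefXY _ _)) // (leq_trans pm) //; exact: le_sq.
have [f_le1|f_gt1] := leqP (size f) 1.
  have [fE [f0 sf]] := const f k f_neq0 bf (leq_addr _ _) f_le1.
  by exists f`_0; split=> //; exists 1, 0; rewrite mul1r mul0r addr0.
have [g_le1|g_gt1] := leqP (size g) 1.
  have [gE [g0 sg]] := const g e g_neq0 bg (leq_addl _ _) g_le1.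
  by exists g`_0; split=> //; exists 0, 1; rewrite mul1r mul0r add0r.
exists (resultant f g); split.
- rewrite resultant_eq0; apply/negP => /(irreducible_dvd_gcdp irr_f f_gt1).
  exact: ndiv.
- exact: size_resultant.
- by have [[u v] _ E] := resultant_in_ideal f_gt1 g_gt1; exists u, v.
Qed.

Lemma irreducible_elt_iso (A B : idomainType) (phi : {rmorphism A -> B})
    (psi : {rmorphism B -> A}) (a : A) :
  cancel phi psi -> cancel psi phi -> irreducible_elt a -> irreducible_elt (phi a).
Proof.
move=> phiK psiK [a0 aU irr_a]; split.
- by apply: contra_neq a0 => pa0; rewrite -[a]phiK pa0 rmorph0.
- by apply: contraNN aU => /(rmorph_unit psi); rewrite phiK.
move=> g h E; have /irr_a : a = psi g * psi h by rewrite -rmorphM -E phiK.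
by case=> /(rmorph_unit phi); rewrite psiK; [left|right].
Qed.

Lemma eliminate_inner k e f g :
  irreducible_elt f -> bideg_le k f -> bideg_le e g ->
  ~ (exists q, g = q * f) ->
  exists h : {poly F}, [/\ h != 0, (size h <= ((k + e) ^ 2).+1)%N &
    exists u v, h^:P = u * f + v * g].
Proof.
move=> irr_f bf bg ndiv.
have irr_sf : irreducible_elt (swapXY f).
  by apply: irreducible_elt_iso irr_f; exact: swapXYK.
have := @eliminate_outer k e (swapXY f) (swapXY g) irr_sf.
rewrite !bideg_le_swap => /(_ bf bg) [].
  case=> q gE; apply: ndiv; exists (swapXY q).
  by rewrite -[g]swapXYK gE rmorphM /= swapXYK.
move=> h [h0 sh [u [v E]]]; exists h; split=> //.
exists (swapXY u), (swapXY v).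
by rewrite -swapXY_polyC E rmorphD !rmorphM /= !swapXYK.
Qed.

End Elimination.

Lemma covered_root (A : idomainType) (p : {poly A}) :
  p != 0 -> covered (size p).-1 (fun x => p.[x] = 0).
Proof.
have [n] := ubnP (size p); elim: n => // n IHn in p * => lt_pn p0.
have [[x /rootP px]|nr] := pselect (exists x, p.[x] = 0); last first.
  by exists [::]; split=> // x px; case: nr; exists x.
have /factor_theorem[q pE] := px.
have q0 : q != 0 by apply: contra_neq p0 => q0; rewrite pE q0 mul0r.
have sp : size p = (size q).+1 by rewrite pE size_Mmonic ?monicXsubC // size_XsubC addn2.
have [|s [sq sQ]] := IHn q _ q0; first by rewrite -ltnS -sp.
exists (x :: s); split; first by rewrite sp /= (leq_ltn_trans sq) // ltn_predL size_poly_gt0.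
move=> y /eqP; rewrite pE hornerM mulf_eq0 !hornerE subr_eq0 inE.
by case/orP => [/eqP/sQ ->|->]; rewrite ?orbT.
Qed.

(** The outer variable is the first coordinate. The polynomial comes last so that the partial
    application is a ring morphism. *)
Definition bisubst (A : nzRingType) (L : nzRingType) (iota : A -> L)
    (x y : L) (p : {poly {poly A}}) : L :=
  (map_poly (map_poly iota) p).[x, y].

Definition common_bound (k e : nat) : nat := (k + e) ^ 2 * (k + e) ^ 2.

(** A weak form of Bezout's theorem: both coordinates of a common zero are roots of nonzero
    polynomials of degree at most (k + e)^2. The zeros may lie in an extension of F, since the
    complex zeros of real polynomials are needed for the isotropic tangents. *)
Lemma common_zeros_covered (F L : fieldType) (iota : {rmorphism F -> L}) k e
    (f g : {poly {poly F}}) :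
  irreducible_elt f -> bideg_le k f -> bideg_le e g ->
  ~ (exists q, g = q * f) ->
  covered (common_bound k e) (fun z : L * L =>
    bisubst iota z.1 z.2 f = 0 /\ bisubst iota z.1 z.2 g = 0).
Proof.
move=> irr_f bf bg ndiv.
have [h [h0 sh [u [v hE]]]] := eliminate_outer irr_f bf bg ndiv.
have [h' [h'0 sh' [u' [v' h'E]]]] := eliminate_inner irr_f bf bg ndiv.
have rootc (p : {poly F}) : p != 0 -> (size p <= ((k + e) ^ 2).+1)%N ->
    covered ((k + e) ^ 2) (fun x => (map_poly iota p).[x] = 0).
  move=> p0 sp; have p'0 : map_poly iota p != 0 by rewrite map_poly_eq0.
  apply: covered_sub (covered_root p'0) => //; rewrite size_map_poly.
  by case: (size p) sp.
have := covered_pair (rootc h' h'0 sh') (fun _ _ => rootc h h0 sh).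
apply: covered_sub => // -[x y] /= [fz gz]; split.
  have := congr1 (fun p => (map_poly (map_poly iota) p).[x, y]) h'E.
  rewrite /= rmorphD !rmorphM /= !hornerE.
  rewrite -/(bisubst iota x y f) -/(bisubst iota x y g) fz gz !mulr0 addr0 => <-.
  rewrite -map_poly_comp (eq_map_poly (g := polyC \o iota)).
    rewrite map_poly_comp; move: (map_poly iota h') => q.
    by rewrite -[LHS](hornerC _ y) -(horner_map polyC).
  by move=> c /=; rewrite map_polyC.
have := congr1 (fun p => (map_poly (map_poly iota) p).[x, y]) hE.
rewrite /= rmorphD !rmorphM /= !hornerE.
rewrite -/(bisubst iota x y f) -/(bisubst iota x y g) fz gz !mulr0 addr0 => <-.
by rewrite map_polyC hornerC.
Qed.

(** * Substitution into bivariate polynomials *)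

Section Bisubst.
Variables (A : comNzRingType).
Implicit Types (p q : {poly {poly A}}).

Lemma bipoly_ind (P : {poly {poly A}} -> Prop) :
  (forall c, P c%:P%:P) -> P 'X -> P 'Y ->
  (forall p q, P p -> P q -> P (p + q)) ->
  (forall p q, P p -> P q -> P (p * q)) -> forall p, P p.
Proof.
move=> PC PX PY PD PM; elim/poly_ind => [|p c Pp]; first by rewrite -!polyC0.
apply: (PD); first by apply: PM.
elim/poly_ind: c => [|c a Pc]; first by rewrite -polyC0.
rewrite polyCD polyCM; apply: PD; last exact: PC.
by apply: PM.
Qed.

Variables (L : comNzRingType) (iota : {rmorphism A -> L}) (x y : L).
Local Notation ev := (bisubst iota x y).

Lemma bisubst_is_zmod_morphism : zmod_morphism ev.
Proof. by move=> p q; rewrite /bisubst rmorphB !hornerE. Qed.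
Lemma bisubst_is_monoid_morphism : monoid_morphism ev.
Proof. by split=> [|p q]; rewrite /bisubst ?rmorph1 ?rmorphM /= !hornerE. Qed.

Lemma bisubstD p q : ev (p + q) = ev p + ev q.
Proof. by rewrite /bisubst rmorphD !hornerE. Qed.
Lemma bisubstB p q : ev (p - q) = ev p - ev q.
Proof. by rewrite /bisubst rmorphB !hornerE. Qed.
Lemma bisubstN p : ev (- p) = - ev p.
Proof. by rewrite /bisubst rmorphN !hornerE. Qed.
Lemma bisubstM p q : ev (p * q) = ev p * ev q.
Proof. by rewrite /bisubst rmorphM /= !hornerE. Qed.
Lemma bisubstC c : ev c%:P%:P = iota c.
Proof. by rewrite /bisubst !map_polyC /= map_polyC !hornerC. Qed.
Lemma bisubst_X : ev 'X = x.
Proof. by rewrite /bisubst map_polyX hornerX hornerC. Qed.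
Lemma bisubst_Y : ev 'Y = y.
Proof. by rewrite /bisubst map_polyC /= map_polyX hornerC hornerX. Qed.
Lemma bisubst1 : ev 1 = 1.
Proof. by rewrite -!polyC1 bisubstC rmorph1. Qed.

Definition bisubstE := (bisubstD, bisubstB, bisubstN, bisubstM, bisubstC, bisubst_X, bisubst_Y).

Lemma bisubst_expr p n : ev (p ^+ n) = ev p ^+ n.
Proof. by elim: n => [|n IHn]; rewrite ?expr0 ?bisubst1 // !exprS bisubstM IHn. Qed.

End Bisubst.

Lemma bisubst_morph (A L M : comNzRingType) (iota : {rmorphism A -> L})
    (theta : {rmorphism L -> M}) (kappa : {rmorphism A -> M}) p x y :
  (forall c, kappa c = theta (iota c)) ->
  theta (bisubst iota x y p) = bisubst kappa (theta x) (theta y) p.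
Proof.
move=> kE; elim/bipoly_ind: p => [c|||p q IHp IHq|p q IHp IHq].
- by rewrite !bisubstC kE.
- by rewrite !bisubst_X.
- by rewrite !bisubst_Y.
- by rewrite !bisubstD rmorphD IHp IHq.
- by rewrite !bisubstM rmorphM IHp IHq.
Qed.

HB.instance Definition _ (A L : comNzRingType) (iota : {rmorphism A -> L}) (x y : L) :=
  GRing.isZmodMorphism.Build {poly {poly A}} L (bisubst iota x y)
    (bisubst_is_zmod_morphism iota x y).
HB.instance Definition _ (A L : comNzRingType) (iota : {rmorphism A -> L}) (x y : L) :=
  GRing.isMonoidMorphism.Build {poly {poly A}} L (bisubst iota x y)
    (bisubst_is_monoid_morphism iota x y).

Section BisubstTheory.
Variable A : comNzRingType.
Implicit Types (p q P Q : {poly {poly A}}).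

Definition bicomp p P Q := bisubst (polyC \o polyC) P Q p.

Lemma bisubst_bicomp (L : comNzRingType) (iota : {rmorphism A -> L}) p P Q x y :
  bisubst iota x y (bicomp p P Q) =
  bisubst iota (bisubst iota x y P) (bisubst iota x y Q) p.
Proof.
have := @bisubst_morph A {poly {poly A}} L (polyC \o polyC) (bisubst iota x y) iota p P Q.
by apply=> c /=; rewrite bisubstC.
Qed.

Lemma bisubst_id p x y : bisubst idfun x y p = p.[x, y].
Proof. by rewrite /bisubst !map_poly_id // => c _; rewrite map_poly_id. Qed.

Lemma bicompE p P Q x y : (bicomp p P Q).[x, y] = p.[P.[x, y], Q.[x, y]].
Proof. by rewrite -!bisubst_id bisubst_bicomp. Qed.

Lemma bideg_le_mono k l p : (k <= l)%N -> bideg_le k p -> bideg_le l p.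
Proof. by rewrite -ltnS => kl /andP[p1 p2]; apply/andP; split; apply: leq_trans kl. Qed.

Lemma bideg_leC c : bideg_le 0 (c%:P%:P : {poly {poly A}}).
Proof.
rewrite /bideg_le sizeYE swapXY_polyC map_polyC !size_polyC.
by rewrite polyC_eq0; case: (c != 0).
Qed.

Lemma bideg_leX : bideg_le 1 ('X : {poly {poly A}}).
Proof. by rewrite /bideg_le sizeYE swapXY_X size_polyX size_polyC polyX_eq0. Qed.

Lemma bideg_leY : bideg_le 1 ('Y : {poly {poly A}}).
Proof. by rewrite /bideg_le sizeYE swapXY_Y size_polyX size_polyC polyX_eq0. Qed.

Lemma bideg_leD k l p q : bideg_le k p -> bideg_le l q -> bideg_le (maxn k l) (p + q).
Proof.
rewrite /bideg_le !sizeYE rmorphD /= => /andP[p1 p2] /andP[q1 q2].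
by apply/andP; split; rewrite (leq_trans (size_polyD _ _)) // geq_max -maxnSS !leq_max ?p1 ?p2 ?q1 ?q2 ?orbT.
Qed.

Lemma bideg_leD_same k p q : bideg_le k p -> bideg_le k q -> bideg_le k (p + q).
Proof. by move=> pk qk; rewrite -[k]maxnn bideg_leD. Qed.

Lemma bideg_leN k p : bideg_le k (- p) = bideg_le k p.
Proof. by rewrite /bideg_le !sizeYE (raddfN swapXY) /= 2!size_polyN. Qed.

Lemma bideg_leM k l p q : bideg_le k p -> bideg_le l q -> bideg_le (k + l) (p * q).
Proof.
have aux (a b m n r : nat) : (a <= m.+1)%N -> (b <= n.+1)%N -> (r <= (a + b).-1)%N -> (r <= (m + n).+1)%N.
  by lia.
rewrite /bideg_le !sizeYE rmorphM /= => /andP[p1 p2] /andP[q1 q2].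
by apply/andP; split; [apply: aux p1 q1 _ | apply: aux p2 q2 _]; apply: size_polyMleq.
Qed.

Lemma bideg_leXn k p n : bideg_le k p -> bideg_le (n * k) (p ^+ n).
Proof.
move=> pk; elim: n => [|n IHn]; first by rewrite expr0 mul0n -!polyC1 bideg_leC.
by rewrite exprS mulSn bideg_leM.
Qed.

Lemma bideg_le_sum k (I : Type) (r : seq I) (P : pred I) (F : I -> {poly {poly A}}) :
  (forall i, P i -> bideg_le k (F i)) -> bideg_le k (\sum_(i <- r | P i) F i).
Proof.
move=> FP; elim/big_ind: _ => //; last by move=> *; apply: bideg_leD_same.
by apply: (@bideg_le_mono 0) => //; rewrite -!polyC0 bideg_leC.
Qed.

Lemma poly_wideE (S : nzRingType) n (p : {poly S}) : (size p <= n)%N ->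
  p = \sum_(i < n) (p`_i)%:P * 'X^i.
Proof.
move=> pn; apply/polyP => i; rewrite coef_sum.
under eq_bigr do rewrite coefCM coefXn.
have [lt_in|le_ni] := ltnP i n.
  rewrite (bigD1 (Ordinal lt_in)) //= eqxx mulr1 big1 ?addr0 // => j ji.
  by rewrite (_ : (i == j :> nat) = false) ?mulr0 //; apply: contraNF ji => /eqP ij; apply/eqP/val_inj.
rewrite nth_default ?(leq_trans pn) // big1 // => j _.
by rewrite gtn_eqF ?mulr0 // (leq_trans (ltn_ord j)).
Qed.

Lemma bipoly_wideE k p : bideg_le k p ->
  p = \sum_(i < k.+1) \sum_(j < k.+1) (p`_i`_j)%:P%:P * 'Y ^+ j * 'X ^+ i.
Proof.
move=> /andP[pk pk']; rewrite {1}(poly_wideE pk); apply: eq_bigr => i _.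
rewrite -mulr_suml; congr (_ * _).
rewrite {1}(poly_wideE (leq_trans (max_size_coefXY p i) pk')) rmorph_sum.
by apply: eq_bigr => j _; rewrite /= rmorphM rmorphXn.
Qed.

(** Each monomial of p contributes at most k factors P and k factors Q. *)
Lemma bideg_le_comp k e p P Q :
  bideg_le k p -> bideg_le e P -> bideg_le e Q -> bideg_le (2 * k * e) (bicomp p P Q).
Proof.
move=> pk Pe Qe; rewrite (bipoly_wideE pk) /bicomp rmorph_sum.
apply: bideg_le_sum => i _; rewrite rmorph_sum; apply: bideg_le_sum => j _.
rewrite /= !bisubstM !bisubst_expr bisubstC bisubst_X bisubst_Y.
apply: (@bideg_le_mono (0 + j * e + i * e)).
  by rewrite add0n -mulnDl leq_mul2r; apply/orP; right; have := ltn_ord i; have := ltn_ord j; lia.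
by rewrite !bideg_leM ?bideg_leXn ?bideg_leC.
Qed.

Definition derivY p := swapXY (swapXY p)^`().

Lemma bideg_le_deriv k p : bideg_le k p -> bideg_le k p^`().
Proof.
have sd (S : nzRingType) (q : {poly S}) : (size q^`() <= size q)%N.
  by have [->|q0] := eqVneq q 0; rewrite ?deriv0 // ltnW // lt_size_deriv.
move=> /andP[pk pk']; rewrite /bideg_le (leq_trans (sd _ _) pk) /=.
apply/bigmax_leqP => i _; rewrite coef_deriv.
rewrite (leq_trans _ pk') // (leq_trans _ (max_size_coefXY p i.+1)) //.
by rewrite -mulr_natr -polyC_natr mulrC mul_polyC size_scale_leq.
Qed.

Lemma bideg_le_derivY k p : bideg_le k p -> bideg_le k (derivY p).
Proof. by rewrite /derivY bideg_le_swap => pk; apply: bideg_le_deriv; rewrite bideg_le_swap. Qed.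

Lemma derivYM p q : derivY (p * q) = derivY p * q + p * derivY q.
Proof. by rewrite /derivY rmorphM derivM rmorphD !rmorphM /= !swapXYK. Qed.

Lemma derivYD p q : derivY (p + q) = derivY p + derivY q.
Proof. by rewrite /derivY rmorphD derivD rmorphD. Qed.

Lemma derivYC (c : A) : derivY c%:P%:P = 0.
Proof. by rewrite /derivY swapXY_polyC map_polyC derivC (rmorph0 swapXY). Qed.

Lemma derivYX : derivY 'X = 0.
Proof. by rewrite /derivY swapXY_X derivC (rmorph0 swapXY). Qed.

Lemma derivYY : derivY 'Y = 1.
Proof. by rewrite /derivY swapXY_Y derivX (rmorph1 swapXY). Qed.

(** The chain rule along the polynomial path (x, y). *)
Lemma bisubst_deriv (K : comNzRingType) (iota : {rmorphism A -> K}) p (x y : {poly K}) :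
  (bisubst (polyC \o iota) x y p)^`() =
  bisubst (polyC \o iota) x y p^`() * x^`() +
  bisubst (polyC \o iota) x y (derivY p) * y^`().
Proof.
elim/bipoly_ind: p => [c|||p q IHp IHq|p q IHp IHq].
- by rewrite bisubstC /= !derivC derivYC !rmorph0 !mul0r addr0.
- by rewrite bisubst_X derivX derivYX rmorph0 rmorph1 mul0r addr0 mul1r.
- by rewrite bisubst_Y derivC derivYY rmorph0 rmorph1 mul0r add0r mul1r.
- by rewrite bisubstD !derivD IHp IHq derivYD !bisubstD; ring.
- by rewrite bisubstM !derivM IHp IHq derivYM !bisubstD !bisubstM; ring.
Qed.

End BisubstTheory.

Section FromMpoly.
Variable A : idomainType.
Implicit Types (f : {mpoly A[2]}).
Let var (i : 'I_2) : {poly {poly A}} := if i == ord0 then 'X else 'Y.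
Definition bipoly_of f : {poly {poly A}} := mmap (polyC \o polyC) var f.
Definition mpoly_of : {poly {poly A}} -> {mpoly A[2]} :=
  bisubst (@mpolyC 2 A) 'X_ord0 'X_(lift ord0 ord0).

HB.instance Definition _ := GRing.RMorphism.on mpoly_of.
HB.instance Definition _ := GRing.RMorphism.copy bipoly_of (mmap (polyC \o polyC) var).

Lemma mpoly2_ind (P : {mpoly A[2]} -> Prop) :
  (forall c, P c%:MP) -> (forall i, P 'X_i) ->
  (forall p q, P p -> P q -> P (p + q)) ->
  (forall p q, P p -> P q -> P (p * q)) -> forall p, P p.
Proof.
move=> PC PX PD PM p; rewrite [p]mpolyE; elim/big_ind: _ => [||m _].
- by rewrite -mpolyC0.
- exact: PD.
rewrite -mul_mpolyC; apply: (PM) => //; rewrite mpolyXE_id.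
elim/big_ind: _ => [||i _]; [by rewrite -mpolyC1|exact: PM|].
by elim: (m i) => [|n IHn]; rewrite ?expr0 -?mpolyC1 // exprS; apply: PM.
Qed.

Lemma bipoly_ofX i : bipoly_of 'X_i = var i.
Proof. by rewrite /bipoly_of mmapX mmap1U. Qed.

Lemma bipoly_ofC c : bipoly_of c%:MP = c%:P%:P.
Proof. by rewrite /bipoly_of mmapC. Qed.

Lemma bipoly_ofK : cancel bipoly_of mpoly_of.
Proof.
move=> f; elim/mpoly2_ind: f => [c|i|p q IHp IHq|p q IHp IHq].
- by rewrite bipoly_ofC /mpoly_of bisubstC.
- rewrite bipoly_ofX /var /mpoly_of; case: eqP => [->|/eqP ni]; first by rewrite bisubst_X.
  by rewrite bisubst_Y; congr 'X_ _; apply/val_inj; case: i ni => [[|[|]]].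
- by rewrite !rmorphD /= IHp IHq.
- by rewrite !rmorphM /= IHp IHq.
Qed.

Lemma mpoly_ofK : cancel mpoly_of bipoly_of.
Proof.
move=> f; elim/bipoly_ind: f => [c|||p q IHp IHq|p q IHp IHq].
- by rewrite /mpoly_of bisubstC bipoly_ofC.
- by rewrite /mpoly_of bisubst_X bipoly_ofX.
- by rewrite /mpoly_of bisubst_Y bipoly_ofX.
- by rewrite !rmorphD /= IHp IHq.
- by rewrite !rmorphM /= IHp IHq.
Qed.

Lemma irreducible_bipoly_of f : irreducible_elt f -> irreducible_elt (bipoly_of f).
Proof. by apply: irreducible_elt_iso; [exact: bipoly_ofK|exact: mpoly_ofK]. Qed.

Lemma meval_bipoly_of f (v : 'I_2 -> A) :
  f.@[v] = (bipoly_of f).[v ord0, v (lift ord0 ord0)].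
Proof.
elim/mpoly2_ind: f => [c|i|p q IHp IHq|p q IHp IHq].
- by rewrite mevalC bipoly_ofC !hornerC.
- rewrite mevalXU bipoly_ofX /var; case: eqP => [->|/eqP ni].
    by rewrite hornerX hornerC.
  by rewrite hornerC hornerX; congr v; apply/val_inj; case: i ni => [[|[|]]].
- by rewrite mevalD rmorphD !hornerD IHp IHq.
- by rewrite mevalM rmorphM !hornerM IHp IHq.
Qed.

Lemma bideg_bipoly_of f k : (msize f <= k.+1)%N -> bideg_le k (bipoly_of f).
Proof.
move=> fk; rewrite [f]mpolyE rmorph_sum big_seq.
apply: bideg_le_sum => m /msize_mdeg_lt /leq_trans /(_ fk); rewrite ltnS => mk.
rewrite -mul_mpolyC rmorphM /= bipoly_ofC -[k]add0n.
apply: bideg_leM; first exact: bideg_leC.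
rewrite /bipoly_of mmapX /mmap1 big_ord_recl big_ord1 /var /=.
apply: (@bideg_le_mono _ (m ord0 * 1 + m (lift ord0 ord0) * 1)%N).
  by move: mk; rewrite mdegE big_ord_recl big_ord1 !muln1.
by apply: bideg_leM; apply: bideg_leXn; [exact: bideg_leX|exact: bideg_leY].
Qed.

End FromMpoly.

(** * Intersections with lines and circles *)

Lemma size_bisubst (A L : comNzRingType) (iota : {rmorphism A -> {poly L}}) k n
    (p : {poly {poly A}}) (x y : {poly L}) :
  (forall c, (size (iota c) <= 1)%N) -> (size x <= n.+1)%N -> (size y <= n.+1)%N ->
  bideg_le k p -> (size (bisubst iota x y p) <= (2 * k * n).+1)%N.
Proof.
move=> si sx sy pk; rewrite (bipoly_wideE pk) rmorph_sum /=.
apply: (leq_trans (size_sum _ _ _)); apply/bigmax_leqP => i _.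
rewrite rmorph_sum /=; apply: (leq_trans (size_sum _ _ _)); apply/bigmax_leqP => j _.
rewrite !bisubstM !bisubst_expr bisubstC bisubst_X bisubst_Y.
have se (z : {poly L}) m : (size z <= n.+1)%N -> (m <= k)%N -> (size (z ^+ m) <= (k * n).+1)%N.
  move=> sz mk; rewrite (leq_trans (size_poly_exp_leq _ _)) // ltnS mulnC leq_mul //.
  by case: (size z) sz.
have := se _ _ sx (ltn_ord i : i <= k)%N; have := se _ _ sy (ltn_ord j : j <= k)%N.
have := si p`_i`_j.
move: (iota _) (y ^+ j) (x ^+ i) => a b c sa sb sc.
apply: (leq_trans (size_polyMleq _ _)); have := size_polyMleq a b.
by move: (size a) (size b) (size c) (size (a * b)) sa sb sc => ? ? ? ?; lia.
Qed.

(** The largest degree that meets f in a Bezout argument is that of the linkage polynomial,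
    16 d + 16 ([bideg_linkage_poly]). *)
Definition K_of (d : nat) : nat := common_bound d (16 * d + 16).

Lemma common_bound_mono k e e' : (e <= e')%N -> (common_bound k e <= common_bound k e')%N.
Proof. by move=> ee; rewrite /common_bound leq_mul // leq_exp2r // leq_add2l. Qed.

Lemma K_ge d : (0 < d)%N -> (2 * d < K_of d)%N.
Proof. by rewrite /K_of /common_bound; nia. Qed.

Section Plane.
Variable R : realType.
Implicit Types (p q o u v w : R * R).

Definition sqd p q : R := (p.1 - q.1) ^+ 2 + (p.2 - q.2) ^+ 2.
Definition cross u v : R := u.1 * v.2 - u.2 * v.1.
Definition along p v (t : R) : R * R := (p.1 + t * v.1, p.2 + t * v.2).
Definition on_curve (f : {poly {poly R}}) q : Prop := f.[q.1, q.2] = 0.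

Definition real_line (C : R * R -> Prop) : Prop :=
  exists p v, v <> 0 /\ forall q, C q <-> exists t, q = along p v t.
Definition real_circle (C : R * R -> Prop) : Prop :=
  exists o r, 0 < r /\ forall q, C q <-> sqd q o = r.

Definition restrict_line (f : {poly {poly R}}) p v : {poly R} :=
  bisubst polyC (p.1%:P + v.1 *: 'X) (p.2%:P + v.2 *: 'X) f.

Lemma restrict_lineE f p v t : (restrict_line f p v).[t] = f.[(along p v t).1, (along p v t).2].
Proof.
rewrite /restrict_line -bisubst_id -[LHS]/(horner_eval t _).
rewrite (@bisubst_morph _ _ _ polyC (horner_eval t) idfun); last first.
  by move=> c /=; rewrite /horner_eval hornerC.
by rewrite /= /horner_eval !hornerE /=; congr (bisubst _ _ _ _); ring.
Qed.

Lemma sqd_eq0 p q : sqd p q = 0 -> p = q.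
Proof.
case: p q => [a b] [a' b']; rewrite /sqd /= => /eqP.
rewrite paddr_eq0 ?sqr_ge0 // !sqrf_eq0 !subr_eq0.
by case/andP => /eqP -> /eqP ->.
Qed.

Lemma sqd_ge0 p q : 0 <= sqd p q.
Proof. by rewrite addr_ge0 ?sqr_ge0. Qed.

Lemma cross_eq0P p q v : v <> 0 -> cross v (q - p) = 0 -> exists t, q = along p v t.
Proof.
case: p q v => [a b] [a' b'] [c e] v0; rewrite /cross /along /= => E.
have n0 : c ^+ 2 + e ^+ 2 != 0.
  apply/eqP => /eqP; rewrite paddr_eq0 ?sqr_ge0 // !sqrf_eq0 => /andP[/eqP c0 /eqP e0].
  by apply: v0; rewrite c0 e0.
have E' : c * (b' - b) = e * (a' - a) by apply/eqP; rewrite -subr_eq0 E.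
exists (((a' - a) * c + (b' - b) * e) / (c ^+ 2 + e ^+ 2)).
congr (_, _); apply: (mulfI n0).
  rewrite mulrDr mulrA [_ * (_ / _)]mulrC divfK //.
  by have := congr1 ( *%R^~ e) E' => /=; lra.
rewrite mulrDr mulrA [_ * (_ / _)]mulrC divfK //.
by have := congr1 ( *%R^~ c) E' => /=; lra.
Qed.

End Plane.

Section Curve.
Variables (R : realType) (d : nat) (f : {poly {poly R}}).
Hypotheses (d_gt0 : (0 < d)%N) (irr_f : irreducible_elt f) (deg_f : bideg_le d f).
Hypotheses (not_line : ~ real_line (on_curve f)) (not_circle : ~ real_circle (on_curve f)).
Local Notation K := (K_of d).
Local Notation C := (on_curve f).

(** The form of Bezout's theorem used on C throughout, with one bound for all admissible degrees. *)
Lemma bezout e (g : {poly {poly R}}) : bideg_le e g -> (e <= 16 * d + 16)%N ->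
  (exists k, g = k * f) \/ covered K (fun q => C q /\ on_curve g q).
Proof.
move=> bg eb; have [div|ndiv] := pselect (exists k, g = k * f); first by left.
right; have := common_zeros_covered idfun irr_f deg_f bg ndiv.
apply: covered_sub; first exact: common_bound_mono.
by move=> q [fq gq]; rewrite !bisubst_id.
Qed.

Lemma multiple_vanishes (g k : {poly {poly R}}) q : g = k * f -> C q -> on_curve g q.
Proof. by move=> gE fq; rewrite /on_curve gE !hornerM fq mulr0. Qed.

(** If C meets a line in many points, then f divides the equation of the line, so C lies on the
    line; and f restricted to the line has too many roots to be nonzero, so C is the line. *)
Lemma line_covered p v : v <> 0 ->
  covered K (fun q => C q /\ cross v (q - p) = 0).
Proof.
move=> v0; apply: contrapT => ncov.
pose L : {poly {poly R}} := v.1%:P%:P * ('Y - p.2%:P%:P) - v.2%:P%:P * ('X - p.1%:P%:P).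
have LE q : L.[q.1, q.2] = cross v (q - p).
  by rewrite /L !hornerE /cross /=; ring.
have bL : bideg_le 1 L.
  have bC (c : R) : bideg_le 1 (c%:P%:P : {poly {poly R}}) by apply: bideg_le_mono (bideg_leC c).
  by apply: bideg_leD_same; rewrite ?bideg_leN; apply: (@bideg_leM _ 0 1); rewrite ?bideg_leC //;
    apply: bideg_leD_same; rewrite ?bideg_leX ?bideg_leY ?bideg_leN.
have [[k LkE]|cov] := bezout bL (ltac:(lia)); last first.
  by apply: ncov; apply: covered_sub cov => // q [fq qL]; rewrite /on_curve LE.
apply: not_line; exists p, v; split=> // q; split.
  move=> /(multiple_vanishes LkE); rewrite /on_curve LE => /(cross_eq0P v0) [t tE].
  by exists t.
move=> [t ->]; rewrite /on_curve -restrict_lineE.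
suff -> : restrict_line f p v = 0 by rewrite horner0.
apply: contrapT => /eqP phi0; apply: ncov.
apply: covered_sub (covered_image (along p v) (covered_root phi0)).
  rewrite (leq_trans _ (ltnW (K_ge d_gt0))) //.
  suff : (size (restrict_line f p v) <= (2 * d * 1).+1)%N by case: size; rewrite muln1.
  have sl (a b : R) : (size (a%:P + b *: 'X)%R <= 2)%N.
    rewrite (leq_trans (size_polyD _ _)) // geq_max size_polyC (leq_trans (leq_b1 _)) //=.
    by rewrite (leq_trans (size_scale_leq _ _)) // size_polyX.
  by apply: size_bisubst => // c; rewrite size_polyC leq_b1.
move=> q' [fq /(cross_eq0P v0) [s sE]].
by exists s => //; rewrite restrict_lineE -sE.
Qed.

(** If C meets a circle in many points, then the equation of the circle is k * f, quadratic in the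
    outer variable with leading coefficient 1. The factor f cannot have degree 1 in this variable:
    it would be the equation of a graph over the whole second axis, and a circle is bounded.
    Hence k is constant and C is the circle. *)
Lemma circle_covered o r : covered K (fun q => C q /\ sqd q o = r).
Proof.
have K_gt0 : (0 < K)%N by apply: leq_ltn_trans (K_ge d_gt0).
have [r_le0|r_gt0] := leP r 0.
  exists [:: o]; split=> // q [_ qr]; rewrite inE; apply/eqP/sqd_eq0.
  by apply/le_anti; rewrite sqd_ge0 qr r_le0.
apply: contrapT => ncov.
pose Y0 := ('X - o.2%:P : {poly R}).
pose Q : {poly {poly R}} := ('X - o.1%:P%:P) ^+ 2 + ((Y0) ^+ 2 - r%:P)%:P.
have QE q : Q.[q.1, q.2] = sqd q o - r.
  by rewrite /Q /Y0 !hornerE /sqd /=; ring.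
have bQ : bideg_le 2 Q.
  have bC (c : R) e : bideg_le e (c%:P%:P : {poly {poly R}}) by apply: bideg_le_mono (bideg_leC c).
  rewrite /Q /Y0 rmorphB /= rmorphXn /= rmorphB /=.
  by rewrite !bideg_leD_same ?bideg_leN //; rewrite -[2%N]/(2 * 1)%N; apply: bideg_leXn;
    rewrite bideg_leD_same ?bideg_leN ?bideg_leX ?bideg_leY.
have [[k QkE]|cov] := bezout bQ (ltac:(lia)); last first.
  by apply: ncov; apply: covered_sub cov => // q [fq qQ]; rewrite /on_curve QE qQ subrr.
have sQ2 : size (('X - o.1%:P%:P : {poly {poly R}}) ^+ 2) = 3%N.
  by rewrite size_exp_XsubC.
have sQ : size Q = 3%N.
  by rewrite size_polyDl sQ2 // size_polyC; case: (_ != 0).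
have lQ : lead_coef Q = 1.
  rewrite lead_coefDl ?lead_coefXnsubC //; first by rewrite lead_coef_exp lead_coefXsubC expr1n.
  by rewrite sQ2 size_polyC; case: (_ != 0).
have Q0 : Q != 0 by rewrite -size_poly_gt0 sQ.
have k0 : k != 0 by apply: contra_neq Q0 => k0; rewrite QkE k0 mul0r.
have [f0 fU _] := irr_f.
have skf : (size k + size f)%N = 4%N.
  have := sQ; rewrite QkE size_mul // => skf.
  by have := size_poly_gt0 k; rewrite k0; move: (size k) (size f) skf => ? ?; lia.
have lkf : lead_coef k * lead_coef f = 1 by rewrite -lead_coefM -QkE lQ.
have lfU : lead_coef f \is a GRing.unit by apply/unitrPr; exists (lead_coef k); rewrite mulrC.
have lkU : lead_coef k \is a GRing.unit by apply/unitrPr; exists (lead_coef f).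
have sf1 : size f != 1%N.
  apply: contraNneq fU => sf1; rewrite poly_unitE sf1 eqxx /=.
  by move: lfU; rewrite lead_coefE sf1.
have sf2 : size f != 2%N.
  apply/eqP => sf2.
  have [a aU lfE] : exists2 a, a != 0 & lead_coef f = a%:P.
    move: lfU; rewrite poly_unitE => /andP[/eqP s1 u]; exists (lead_coef f)`_0.
      by rewrite -unitfE.
    by apply: size1_polyC; rewrite s1.
  (* The circle does not reach this height: r is the squared radius, and (r + 1)^2 > r. *)
  pose y := o.2 + (r + 1).
  have [x xE] : exists x, a * x = - (f`_0).[y].
    by exists (- (f`_0).[y] / a); rewrite mulrC divfK.
  have fxy : C (x, y).
    have fE : f = (f`_0)%:P + a%:P%:P * 'X.
      apply/polyP => -[|[|i]]; rewrite coefD coefC coefCM coefX /= ?mulr0 ?addr0 ?add0r //.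
        by rewrite mulr1 -lfE lead_coefE sf2.
      by rewrite nth_default ?sf2.
    by rewrite /on_curve fE /= !hornerE xE subrr.
  have := multiple_vanishes QkE fxy; rewrite /on_curve QE /sqd /= /y => E.
  have := sqr_ge0 (x - o.1); nra.
have sf3 : size f = 3%N.
  have sk := size_poly_gt0 k; have sf := size_poly_gt0 f; rewrite k0 in sk; rewrite f0 in sf.
  by move: (size k) (size f) sf1 sf2 skf sk sf => ? ?; lia.
have sk1 : size k = 1%N by move: skf; rewrite sf3; lia.
have kU : k \is a GRing.unit.
  by rewrite poly_unitE sk1 eqxx /=; move: lkU; rewrite lead_coefE sk1.
apply: not_circle; exists o, r; split=> // q; split.
  by move=> /(multiple_vanishes QkE); rewrite /on_curve QE => /subr0_eq.
move=> qr; rewrite /on_curve.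
have -> : f = k^-1 * Q by rewrite QkE mulKr.
by rewrite !hornerM QE qr subrr mulr0.
Qed.

End Curve.

(** * Symmetries of the curve *)

Section Motions.
Variable R : realType.
Implicit Types (p q o u v w : R * R).

Definition rotation (c s : R) w q : R * R :=
  (c * q.1 - s * q.2 + w.1, s * q.1 + c * q.2 + w.2).
Definition reflection (c s : R) w q : R * R :=
  (c * q.1 + s * q.2 + w.1, s * q.1 - c * q.2 + w.2).
Definition translate w q : R * R := (q.1 + w.1, q.2 + w.2).

Definition preserves (C : R * R -> Prop) (tau : R * R -> R * R) : Prop :=
  forall q, C (tau q) <-> C q.

Definition rotation_image C p q : Prop := exists c s w,
  [/\ c ^+ 2 + s ^+ 2 = 1, preserves C (rotation c s w) & rotation c s w p = q].
Definition reflection_image C p q : Prop := exists c s w,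
  [/\ c ^+ 2 + s ^+ 2 = 1, preserves C (reflection c s w) & reflection c s w p = q].

Lemma sqd_rotation c s w p q : c ^+ 2 + s ^+ 2 = 1 ->
  sqd (rotation c s w p) (rotation c s w q) = sqd p q.
Proof.
move=> cs; rewrite /sqd /=.
transitivity ((c ^+ 2 + s ^+ 2) * ((p.1 - q.1) ^+ 2 + (p.2 - q.2) ^+ 2)); first by ring.
by rewrite cs mul1r.
Qed.

Lemma rotation_onto c s w q : c ^+ 2 + s ^+ 2 = 1 -> exists p, rotation c s w p = q.
Proof.
move=> cs; exists (c * (q.1 - w.1) + s * (q.2 - w.2), c * (q.2 - w.2) - s * (q.1 - w.1)).
rewrite /rotation /=; case: q => a b /=; congr (_, _).
  transitivity ((c ^+ 2 + s ^+ 2) * (a - w.1) + w.1); first by ring.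
  by rewrite cs; ring.
transitivity ((c ^+ 2 + s ^+ 2) * (b - w.2) + w.2); first by ring.
by rewrite cs; ring.
Qed.

End Motions.

Section Symmetries.
Variables (R : realType) (d : nat) (f : {poly {poly R}}).
Hypotheses (d_gt0 : (0 < d)%N) (irr_f : irreducible_elt f) (deg_f : bideg_le d f).
Hypotheses (not_line : ~ real_line (on_curve f)) (not_circle : ~ real_circle (on_curve f)).
Local Notation K := (K_of d).
Local Notation C := (on_curve f).

Lemma along_nat_uncovered n (w q : R * R) : w <> 0 ->
  ~ covered n (fun p => exists m : nat, p = along q w m%:R).
Proof.
move=> w0 [l [ln lP]].
pose s := [seq along q w (i : nat)%:R | i <- iota 0 n.+1].
have us : uniq s.
  rewrite map_inj_uniq ?iota_uniq // => i j [/addrI E1 /addrI E2].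
  apply/eqP; rewrite -(@eqr_nat R); apply/eqP.
  have [w1|w1] := eqVneq w.1 0; last exact: (mulIf w1).
  have [w2|w2] := eqVneq w.2 0; last exact: (mulIf w2).
  by case: w0; case: (w) w1 w2 => a b /= -> ->.
have : {subset s <= l} by move=> _ /mapP[i _ ->]; apply: lP; exists i.
by move=> /(uniq_leq_size us); rewrite size_map size_iota leqNgt ltnS ln.
Qed.

Lemma no_line (q w : R * R) : w <> 0 -> ~ (forall m : nat, C (along q w m%:R)).
Proof.
move=> w0 Cn; apply: (along_nat_uncovered (n := K) (q := q) w0).
apply: covered_sub (line_covered d_gt0 irr_f deg_f not_line q w0) => // _ [m ->].
by split; [exact: Cn | rewrite /cross /along /=; ring].
Qed.

(** The orbit of a point under a translation is an infinite subset of a line. *)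
Lemma no_translation w q : (forall p, C p -> C (translate w p)) -> C q -> w = 0.
Proof.
move=> trC Cq; apply: contrapT => w0; apply: (no_line (q := q) w0).
elim=> [|n /trC]; first by rewrite /along !mul0r !addr0; case: (q) Cq.
by congr C; rewrite /along /translate /= -natr1; congr (_, _); ring.
Qed.

(** The commutator of two orientation-preserving isometries is a translation, and C has no
    translational symmetry; so they commute and share the fixed point o of one that is not the
    identity. All images of p lie on the circle about o through p. *)
Lemma rotation_images_covered p : C p -> covered K (rotation_image C p).
Proof.
move=> Cp.
have [[c [s [w [cs pres moved]]]]|fixed] := pselect (exists c s w,
    [/\ c ^+ 2 + s ^+ 2 = 1, preserves C (rotation c s w) & rotation c s w p <> p]); last first.
  exists [:: p]; split; first by rewrite (leq_ltn_trans _ (K_ge d_gt0)).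
  move=> q [c [s [w [cs pres <-]]]]; rewrite inE; apply/eqP; apply: contrapT => moved.
  by apply: fixed; exists c, s, w.
have c_neq1 : 1 - c != 0.
  apply/eqP => c1; have c1' : c = 1 by lra.
  have s0 : s = 0 by apply/eqP; rewrite -sqrf_eq0; apply/eqP; move: cs; rewrite c1'; lra.
  apply: moved; have -> : w = 0.
    apply: (no_translation _ Cp) => q Cq; suff -> : translate w q = rotation c s w q by apply/pres.
    by rewrite /translate /rotation c1' s0; congr (_, _); ring.
  by rewrite /rotation c1' s0; case: (p) => a b; congr (_, _) => /=; ring.
pose D := (1 - c) ^+ 2 + s ^+ 2.
have DE : D = 2 * (1 - c) by rewrite /D; lra.
have D0 : D != 0 by rewrite DE mulf_neq0 // pnatr_eq0.
pose o := (((1 - c) * w.1 - s * w.2) / D, ((1 - c) * w.2 + s * w.1) / D).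
have fix_o : rotation c s w o = o.
  have o1E : o.1 * D = (1 - c) * w.1 - s * w.2 by rewrite /o /= divfK.
  have o2E : o.2 * D = (1 - c) * w.2 + s * w.1 by rewrite /o /= divfK.
  rewrite /rotation; case: (o) o1E o2E => a b /= aE bE; congr (_, _); apply: (mulIf D0).
    by transitivity (c * (a * D) - s * (b * D) + w.1 * D); [ring|rewrite aE bE /D; ring].
  by transitivity (s * (a * D) + c * (b * D) + w.2 * D); [ring|rewrite aE bE /D; ring].
have uniq_o q : rotation c s w q = q -> q = o.
  move=> qE; have := congr1 fst qE; have := congr1 snd qE.
  rewrite /rotation /= => E2 E1; rewrite /o; case: (q) E1 E2 => a b /= E1 E2.
  congr (_, _); apply: (mulIf D0); rewrite divfK // /D.
    have -> : w.1 = (1 - c) * a + s * b by lra.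
    have -> : w.2 = (1 - c) * b - s * a by lra.
    by ring.
  have -> : w.1 = (1 - c) * a + s * b by lra.
  have -> : w.2 = (1 - c) * b - s * a by lra.
  by ring.
apply: covered_sub (circle_covered d_gt0 irr_f deg_f not_circle o (sqd p o)) => //.
move=> _ [c' [s' [w' [cs' pres' <-]]]]; split; first exact/pres'.
pose tau := rotation c' s' w'; pose tau1 := rotation c s w.
pose z : R * R := ((tau (tau1 0)).1 - (tau1 (tau 0)).1, (tau (tau1 0)).2 - (tau1 (tau 0)).2).
have commE q : tau (tau1 q) = translate z (tau1 (tau q)).
  by rewrite /z /tau /tau1 /translate /rotation /=; congr (_, _); ring.
have z0 : z = 0.
  apply: (no_translation _ Cp) => q.
  have [q1 <-] := rotation_onto w q cs; have [q2 <-] := rotation_onto w' q1 cs'.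
  by rewrite -/tau -/tau1 -commE => /pres /pres' Cq; apply/pres'/pres.
have tau_o : tau o = o.
  apply: uniq_o; have {2}-> : o = tau1 o by rewrite [RHS]fix_o.
  by rewrite commE z0 /translate !addr0 -surjective_pairing.
by rewrite -{1}tau_o sqd_rotation.
Qed.

(** The orientation-reversing symmetries are the compositions of one of them with the
    orientation-preserving ones. *)
Lemma reflection_images_covered p : C p -> covered K (reflection_image C p).
Proof.
move=> Cp.
have [[q [c [s [w [cs pres qE]]]]]|none] := pselect (exists q, reflection_image C p q); last first.
  by exists [::]; split=> // q pq; case: none; exists q.
have Cq : C q by rewrite -qE; apply/pres.
apply: covered_sub (rotation_images_covered Cq) => // _ [c' [s' [w' [cs' pres' <-]]]].
pose c2 := c' * c + s' * s; pose s2 := s' * c - c' * s.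
pose w2 : R * R := (w'.1 - (c2 * w.1 - s2 * w.2), w'.2 - (s2 * w.1 + c2 * w.2)).
have compE x : rotation c2 s2 w2 (reflection c s w x) = reflection c' s' w' x.
  rewrite /rotation /reflection /w2 /c2 /s2; case: x => a b /=; congr (_, _).
    transitivity ((c ^+ 2 + s ^+ 2) * (c' * a + s' * b) + w'.1); first by ring.
    by rewrite cs; ring.
  transitivity ((c ^+ 2 + s ^+ 2) * (s' * a - c' * b) + w'.2); first by ring.
  by rewrite cs; ring.
have invol x : exists y, reflection c s w y = x.
  exists (c * (x.1 - w.1) + s * (x.2 - w.2), s * (x.1 - w.1) - c * (x.2 - w.2)).
  rewrite /reflection /=; case: x => a b /=; congr (_, _).
    transitivity ((c ^+ 2 + s ^+ 2) * (a - w.1) + w.1); first by ring.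
    by rewrite cs; ring.
  transitivity ((c ^+ 2 + s ^+ 2) * (b - w.2) + w.2); first by ring.
  by rewrite cs; ring.
exists c2, s2, w2; split.
- transitivity ((c ^+ 2 + s ^+ 2) * (c' ^+ 2 + s' ^+ 2)); last by rewrite cs cs' mulr1.
  by rewrite /c2 /s2; ring.
- move=> x; have [y <-] := invol x; rewrite compE; split.
    by move=> /pres' Cy; apply/pres.
  by move=> /pres Cy; apply/pres'.
- by rewrite -qE compE.
Qed.

End Symmetries.

(** * The linkage polynomial *)

(** The splitting F(x, y) = E(x^2, y) + x O(x^2, y). *)
Lemma bisubst_even_odd (A L : comNzRingType) (iota : {rmorphism A -> L}) (x y : L)
    (p : {poly {poly A}}) :
  bisubst iota x y p =
  bisubst iota (x ^+ 2) y (even_poly p) + x * bisubst iota (x ^+ 2) y (odd_poly p).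
Proof.
have sq (q : {poly {poly A}}) : bisubst iota x y (q \Po 'X^2) = bisubst iota (x ^+ 2) y q.
  by rewrite /bisubst map_comp_poly /= map_polyXn horner_comp hornerXn -rmorphXn.
by rewrite -{1}[p]poly_even_odd bisubstD bisubstM bisubst_X !sq [x * _]mulrC.
Qed.

Lemma bideg_even_poly (A : nzRingType) k (p : {poly {poly A}}) :
  bideg_le k p -> bideg_le k (even_poly p).
Proof.
move=> /andP[pk pk']; apply/andP; split.
  by rewrite (leq_trans (size_even_poly _)) //; move: pk; case: size => [|n] //; lia.
apply/bigmax_leqP => i _; rewrite coef_even_poly.
exact: leq_trans (max_size_coefXY _ _) pk'.
Qed.

Lemma bideg_odd_poly (A : nzRingType) k (p : {poly {poly A}}) :
  bideg_le k p -> bideg_le k (odd_poly p).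
Proof.
move=> /andP[pk pk']; apply/andP; split.
  by rewrite (leq_trans (size_odd_poly _)) //; move: pk; case: size => [|n] //; lia.
apply/bigmax_leqP => i _; rewrite coef_odd_poly.
exact: leq_trans (max_size_coefXY _ _) pk'.
Qed.

Section Frame.
Variable R : realType.
Implicit Types (p q : R * R) (f : {poly {poly R}}).

Definition cst (c : R) : {poly {poly R}} := c%:P%:P.

(** The equation of C in the coordinates (eta, xi) of the point a + xi e + eta n, where e = b - a
    and n is e turned by a right angle; eta is the outer variable. *)
Definition in_frame f (a b : R * R) : {poly {poly R}} :=
  bicomp f (cst a.1 + cst (b.1 - a.1) * 'Y - cst (b.2 - a.2) * 'X)
           (cst a.2 + cst (b.2 - a.2) * 'Y + cst (b.1 - a.1) * 'X).

Lemma bisubst_in_frame (L : comNzRingType) (iota : {rmorphism R -> L}) f a b x y :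
  bisubst iota y x (in_frame f a b) =
  bisubst iota (iota a.1 + iota (b.1 - a.1) * x - iota (b.2 - a.2) * y)
               (iota a.2 + iota (b.2 - a.2) * x + iota (b.1 - a.1) * y) f.
Proof. by rewrite bisubst_bicomp /cst !bisubstE. Qed.

Lemma bideg_cst k c : bideg_le k (cst c).
Proof. exact: bideg_le_mono (bideg_leC c). Qed.

Lemma bideg_in_frame k f a b : bideg_le k f -> bideg_le (2 * k) (in_frame f a b).
Proof.
move=> fk; rewrite -[(2 * k)%N]muln1; apply: bideg_le_comp => //.
  apply: bideg_leD_same; first (apply: bideg_leD_same; first exact: bideg_cst).
    by apply: (@bideg_leM _ 0 1); rewrite ?bideg_cst ?bideg_leY.
  by rewrite bideg_leN; apply: (@bideg_leM _ 0 1); rewrite ?bideg_cst ?bideg_leX.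
apply: bideg_leD_same; first (apply: bideg_leD_same; first exact: bideg_cst).
  by apply: (@bideg_leM _ 0 1); rewrite ?bideg_cst ?bideg_leY.
by apply: (@bideg_leM _ 0 1); rewrite ?bideg_cst ?bideg_leX.
Qed.

Variables (a b a' b' : R * R).
Local Notation sb := (sqd a' b').

(** If |pa| = |p'a'| and |pb| = |p'b'|, then the coordinates of p' in the frame of a', b' satisfy
    xi' = xi p and eta'^2 = eta2 p: both are polynomials in p, while eta' has two values. *)
Definition xi p : R :=
  (2 * ((p.1 - a.1) * (b.1 - a.1) + (p.2 - a.2) * (b.2 - a.2)) - sqd a b + sb) / (2 * sb).
Definition eta2 p : R := sqd p a / sb - xi p ^+ 2.

Definition xi_poly : {poly {poly R}} :=
  cst ((b.1 - a.1) / sb) * ('X - cst a.1) + cst ((b.2 - a.2) / sb) * ('Y - cst a.2)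
  + cst ((sb - sqd a b) / (2 * sb)).
Definition eta2_poly : {poly {poly R}} :=
  cst sb^-1 * (('X - cst a.1) ^+ 2 + ('Y - cst a.2) ^+ 2) - xi_poly ^+ 2.

(** The product of f over the two points with coordinates (eta, xi) and (- eta, xi), which is even
    in eta and so a polynomial in eta^2 and xi: (E + eta O) (E - eta O) = E^2 - eta^2 O^2. *)
Definition linkage_poly f : {poly {poly R}} :=
  bicomp (even_poly (in_frame f a' b')) eta2_poly xi_poly ^+ 2
  - eta2_poly * bicomp (odd_poly (in_frame f a' b')) eta2_poly xi_poly ^+ 2.

Lemma bideg_xi : bideg_le 1 xi_poly.
Proof.
apply: bideg_leD_same; last exact: bideg_cst.
by apply: bideg_leD_same; apply: (@bideg_leM _ 0 1); rewrite ?bideg_cst //;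
  apply: bideg_leD_same; rewrite ?bideg_leN ?bideg_cst ?bideg_leX ?bideg_leY.
Qed.

Lemma bideg_eta2 : bideg_le 2 eta2_poly.
Proof.
apply: bideg_leD_same; last first.
  by rewrite bideg_leN; apply: (@bideg_leXn _ 1 _ 2); exact: bideg_xi.
apply: (@bideg_leM _ 0 2); first exact: bideg_cst.
by apply: bideg_leD_same; apply: (@bideg_leXn _ 1 _ 2);
  apply: bideg_leD_same; rewrite ?bideg_leN ?bideg_cst ?bideg_leX ?bideg_leY.
Qed.

Lemma bideg_linkage_poly k f : bideg_le k f -> bideg_le (16 * k + 16) (linkage_poly f).
Proof.
move=> /(bideg_in_frame a' b') fk.
have bE := bideg_even_poly fk; have bO := bideg_odd_poly fk.
have bX : bideg_le 2 xi_poly by apply: bideg_le_mono bideg_xi.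
have cE := bideg_leXn 2 (bideg_le_comp bE bideg_eta2 bX).
have cO := bideg_leXn 2 (bideg_le_comp bO bideg_eta2 bX).
apply: bideg_leD_same; first by apply: bideg_le_mono cE; lia.
by rewrite bideg_leN; apply: bideg_le_mono (bideg_leM bideg_eta2 cO); lia.
Qed.

Hypothesis neq' : a' <> b'.

Lemma sb_neq0 : sb != 0.
Proof. by apply/eqP => /sqd_eq0. Qed.

Lemma xi_polyE p : xi_poly.[p.1, p.2] = xi p.
Proof.
have sb0 := sb_neq0; rewrite -bisubst_id /xi_poly /cst /xi !bisubstE /=.
by move: (sqd a b) (sqd a' b') sb0 => u v v0; field; rewrite v0.
Qed.

Lemma eta2_polyE p : eta2_poly.[p.1, p.2] = eta2 p.
Proof.
rewrite -bisubst_id /eta2_poly /cst bisubstB bisubst_expr (bisubst_id xi_poly) xi_polyE.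
by rewrite bisubstM bisubstC bisubstD !bisubst_expr !bisubstE /eta2 /= mulrC.
Qed.

Lemma linkage_polyE f p :
  (linkage_poly f).[p.1, p.2] =
    (even_poly (in_frame f a' b')).[eta2 p, xi p] ^+ 2
    - eta2 p * (odd_poly (in_frame f a' b')).[eta2 p, xi p] ^+ 2.
Proof.
rewrite -!bisubst_id /linkage_poly bisubstB bisubst_expr bisubstM bisubst_expr !bisubst_bicomp.
by rewrite !bisubst_id xi_polyE eta2_polyE.
Qed.

Lemma linkage_polyE_sq f p eta : eta ^+ 2 = eta2 p ->
  (linkage_poly f).[p.1, p.2] =
   (in_frame f a' b').[eta, xi p] * (in_frame f a' b').[- eta, xi p].
Proof.
move=> etaE; have := bisubst_even_odd idfun eta (xi p) (in_frame f a' b').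
have := bisubst_even_odd idfun (- eta) (xi p) (in_frame f a' b').
rewrite !bisubst_id sqrrN etaE linkage_polyE => -> ->.
move: _.[_, _] _.[_, _] => u v.
by rewrite -etaE; ring.
Qed.

Lemma linkage_poly_zero f p p' : sqd p a = sqd p' a' -> sqd p b = sqd p' b' ->
  on_curve f p' -> on_curve (linkage_poly f) p.
Proof.
move=> pa pb fp'; have sb0 := sb_neq0.
pose eta := ((p'.2 - a'.2) * (b'.1 - a'.1) - (p'.1 - a'.1) * (b'.2 - a'.2)) / sb.
have xiE : xi p = ((p'.1 - a'.1) * (b'.1 - a'.1) + (p'.2 - a'.2) * (b'.2 - a'.2)) / sb.
  apply: (mulIf sb0); rewrite /xi divfK //.
  have -> (u : R) : u / (2 * sb) * sb = u / 2 by field; rewrite sb0.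
  by move: pa pb; rewrite /sqd; lra.
have etaE : eta ^+ 2 = eta2 p.
  rewrite /eta2 xiE pa /eta !expr_div_n.
  have -> : ((p'.2 - a'.2) * (b'.1 - a'.1) - (p'.1 - a'.1) * (b'.2 - a'.2)) ^+ 2 =
    sqd p' a' * sb - ((p'.1 - a'.1) * (b'.1 - a'.1) + (p'.2 - a'.2) * (b'.2 - a'.2)) ^+ 2.
    by rewrite /sqd; ring.
  by move: sb0; move: sb (sqd p' a') (_ ^+ 2) => x y z x0; field.
rewrite /on_curve (linkage_polyE_sq f etaE) -[X in X * _]bisubst_id bisubst_in_frame /=.
rewrite xiE (_ : _ + _ - _ = p'.1); last first.
  by rewrite /eta; apply: (mulIf sb0); rewrite /sqd; field; rewrite sb0.
rewrite (_ : _ + _ + _ = p'.2); last first.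
  by rewrite /eta; apply: (mulIf sb0); rewrite /sqd; field; rewrite sb0.
by rewrite bisubst_id fp' mul0r.
Qed.

End Frame.

(** * Isotropic tangents *)

Section Tangency.
Variable R : realType.
Implicit Types (f g h : {poly {poly R}}) (p q : R * R).

Definition grad f q : R * R := (f^`().[q.1, q.2], (derivY f).[q.1, q.2]).

Lemma restrict_lineM f g p v :
  restrict_line (f * g) p v = restrict_line f p v * restrict_line g p v.
Proof. exact: bisubstM. Qed.

Lemma along0 p v : along p v 0 = p.
Proof. by rewrite /along !mul0r !addr0 -surjective_pairing. Qed.

Lemma deriv_restrict_line f p v :
  (restrict_line f p v)^`() = v.1 *: restrict_line f^`() p v + v.2 *: restrict_line (derivY f) p v.
Proof.
have := @bisubst_deriv R R idfun f (p.1%:P + v.1 *: 'X) (p.2%:P + v.2 *: 'X).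
have dl (c e : R) : (c%:P + e *: 'X)^`() = e%:P by rewrite derivD derivC derivZ derivX add0r alg_polyC.
rewrite !dl -[bisubst _ _ _ f]/(restrict_line f p v) => ->.
by rewrite mulrC mul_polyC [_ * (_)%:P]mulrC mul_polyC.
Qed.

Lemma deriv_restrict_line0 f p v :
  (restrict_line f p v)^`().[0] = (grad f p).1 * v.1 + (grad f p).2 * v.2.
Proof.
by rewrite deriv_restrict_line hornerD !hornerZ !restrict_lineE along0 mulrC [v.2 * _]mulrC.
Qed.

Section IsotropicTangent.
Variables (L : fieldType) (iota : {rmorphism R -> L}) (i : L).
Hypothesis i2 : i ^+ 2 = -1.

(** For i^2 = -1 the isotropic line z.1 + i z.2 = const through a has direction (1, i); it is
    tangent to the curve at z. *)
Definition isotropic_tangent f (a : R * R) : Prop := exists z : L * L,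
  [/\ bisubst iota z.1 z.2 f = 0,
      bisubst iota z.1 z.2 f^`() + i * bisubst iota z.1 z.2 (derivY f) = 0 &
      z.1 + i * z.2 = iota a.1 + i * iota a.2].

(** The point with eta = i x0 and xi = x0 lies on the isotropic line through a', since
    eta^2 = - xi^2 there. The hypotheses say that E and O vanish at it and have zero derivative
    along the line, on which (eta^2, xi) = (- xi^2, xi); so F = E + eta O does too. *)
Lemma isotropic_tangent_of_frame f (a' b' : R * R) (x0 : R) :
  a' <> b' ->
  let E := even_poly (in_frame f a' b') in
  let O := odd_poly (in_frame f a' b') in
  E.[- x0 ^+ 2, x0] = 0 -> O.[- x0 ^+ 2, x0] = 0 ->
  - (2 * x0) * E^`().[- x0 ^+ 2, x0] + (derivY E).[- x0 ^+ 2, x0] = 0 ->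
  - (2 * x0) * O^`().[- x0 ^+ 2, x0] + (derivY O).[- x0 ^+ 2, x0] = 0 ->
  isotropic_tangent f a'.
Proof.
move=> neq' E O E0 O0 E1 O1.
have lift (p : {poly {poly R}}) (x y : R) : bisubst iota (iota x) (iota y) p = iota p.[x, y].
  by have := @bisubst_morph R R L idfun iota iota p x y (fun=> erefl); rewrite bisubst_id.
pose X : {poly L} := (iota x0)%:P + 'X; pose Y : {poly L} := i *: X.
have X0 : X.[0] = iota x0 by rewrite /X !hornerE.
have Y0 : Y.[0] = i * iota x0 by rewrite /Y hornerZ X0.
have dX : X^`() = 1 by rewrite /X derivD derivC derivX add0r.
have dY : Y^`() = i%:P by rewrite /Y derivZ dX alg_polyC.
have at0 (p : {poly {poly R}}) (u v : {poly L}) :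
    (bisubst (polyC \o iota) u v p).[0] = bisubst iota u.[0] v.[0] p.
  rewrite -[LHS]/(horner_eval 0 _) (@bisubst_morph _ _ _ (polyC \o iota) (horner_eval 0) iota) //.
  by move=> c; rewrite /= /horner_eval hornerC.
have Y2 : (Y ^+ 2).[0] = iota (- x0 ^+ 2).
  by rewrite horner_exp Y0 exprMn i2 rmorphN rmorphXn mulN1r.
have dY2 : (Y ^+ 2)^`().[0] = iota (- (2 * x0)).
  rewrite expr2 derivM dY hornerD !hornerM !hornerC Y0 rmorphN rmorphM /= rmorph_nat.
  transitivity (i ^+ 2 * (2 * iota x0)); first by ring.
  by rewrite i2; ring.
clearbody Y; clearbody X.
(* F on the isotropic line through a', with origin at xi = x0. *)
pose Phi := bisubst (polyC \o iota) Y X (in_frame f a' b').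
have PhiE : Phi = bisubst (polyC \o iota) (Y ^+ 2) X E + Y * bisubst (polyC \o iota) (Y ^+ 2) X O.
  exact: bisubst_even_odd.
have Phi0 : Phi.[0] = 0.
  by rewrite PhiE hornerD hornerM !at0 Y2 X0 !lift E0 O0 rmorph0 mulr0 addr0.
have Phi1 : Phi^`().[0] = 0.
  rewrite PhiE derivD derivM !bisubst_deriv dX !mulr1.
  rewrite !(hornerD, hornerM) !at0 Y2 dY2 X0 !lift O0 -!(rmorphM iota) -!(rmorphD iota).
  rewrite [_ * - (2 * x0)]mulrC E1 [O^`().[_, _] * _]mulrC O1.
  by rewrite !rmorph0 !mulr0 !addr0.
pose e1 := b'.1 - a'.1; pose e2 := b'.2 - a'.2.
pose U := (iota a'.1)%:P + (iota e1)%:P * X - (iota e2)%:P * Y.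
pose V := (iota a'.2)%:P + (iota e2)%:P * X + (iota e1)%:P * Y.
have PhiF : Phi = bisubst (polyC \o iota) U V f by exact: bisubst_in_frame.
pose k := iota e1 - i * iota e2.
have dU : U^`() = k%:P.
  by rewrite /U !(derivD, derivN, derivM, derivC) dX dY /k polyCB polyCM; ring.
have dV : V^`() = (i * k)%:P.
  rewrite /V !(derivD, derivM, derivC) dX dY /k mulrBr mulrA -expr2 i2 mulN1r opprK.
  by rewrite polyCD polyCM; ring.
(* k = e1 - i e2 is a factor of e1^2 + e2^2 = |a'b'|^2. *)
have k0 : k != 0.
  apply/eqP => /eqP; rewrite /k subr_eq0 => /eqP kE.
  have : iota (e1 ^+ 2 + e2 ^+ 2) = 0.
    by rewrite rmorphD !rmorphXn /= kE exprMn i2 mulN1r addNr.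
  rewrite -(rmorph0 iota) => /fmorph_inj E'.
  by apply: neq'; apply: sqd_eq0; rewrite -E' /sqd /e1 /e2; ring.
have UV : U.[0] + i * V.[0] = iota a'.1 + i * iota a'.2.
  rewrite /U /V !(hornerD, hornerN, hornerM) !hornerC X0 Y0.
  transitivity (iota a'.1 + i * iota a'.2 + (1 + i ^+ 2) * (iota e1 * iota x0)); first by ring.
  by rewrite i2 subrr mul0r addr0.
clearbody U V; exists (U.[0], V.[0]) => /=; split=> //; first by rewrite -at0 -PhiF.
have := Phi1; rewrite PhiF bisubst_deriv dU dV !(hornerD, hornerM) !hornerC !at0 => E'.
by apply: (mulIf k0); rewrite mul0r -[RHS]E' mulrDl -mulrA [i * (_ * k)]mulrCA.
Qed.

(** At p = a one has xi = x0 and eta2 = - x0^2 with x0 != 0, because |ab| and |a'b'| differ. Near a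
    the linkage polynomial E^2 - eta2 O^2 is thus a sum of two squares, and it vanishes at a, so
    E = O = 0 there and its gradient vanishes. As f has nonzero gradient at a, the cofactor k
    vanishes at a. On the tangent line k * f therefore vanishes to third order, so the second-order
    part of the sum of squares is zero, and E and O vanish to second order along the tangent.
    As ab is not normal to C at a, xi moves with nonzero speed along the tangent, and (eta2, xi)
    moves in the direction of (- 2 x0, 1): these are the hypotheses of
    [isotropic_tangent_of_frame]. *)
Lemma linkage_multiple_isotropic f k (a b a' b' : R * R) :
  a' <> b' -> sqd a b <> sqd a' b' -> on_curve f a ->
  linkage_poly a b a' b' f = k * f ->
  cross (grad f a) (b - a) <> 0 ->
  isotropic_tangent f a'.
Proof.
move=> neq' neq fa gE crossN; have sb0 := sb_neq0 neq'.
set sb := sqd a' b' in sb0 neq; set sab := sqd a b in neq.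
pose x0 := (sb - sab) / (2 * sb).
have x00 : x0 != 0.
  rewrite mulf_neq0 ?invr_neq0 ?mulf_neq0 ?pnatr_eq0 // subr_eq0.
  by apply/eqP => E; apply: neq.
pose E := even_poly (in_frame f a' b'); pose O := odd_poly (in_frame f a' b').
pose XP := xi_poly a b a' b'; pose WP := eta2_poly a b a' b'.
have xia : xi a b a' b' a = x0 by rewrite /xi /x0 -/sb -/sab; congr (_ / _); ring.
have eta2a : eta2 a b a' b' a = - x0 ^+ 2.
  by rewrite /eta2 xia /sqd !subrr !expr0n /= addr0 mul0r sub0r.
(* expansion of the linkage polynomial along a line through a *)
pose l v := (v.1 * (b.1 - a.1) + v.2 * (b.2 - a.2)) / sb.
pose xv v := x0%:P + l v *: 'X.
pose wv v := ((v.1 ^+ 2 + v.2 ^+ 2) / sb) *: 'X ^+ 2 - xv v ^+ 2.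
pose ev v := bisubst polyC (wv v) (xv v) E.
pose ov v := bisubst polyC (wv v) (xv v) O.
have xvE v : restrict_line XP a v = xv v.
  rewrite /restrict_line /XP /xi_poly /cst !bisubstE -/sb -/sab -/x0 /xv /l.
  by rewrite -!mul_polyC; move: sb^-1 => s; ring.
have wvE v : restrict_line WP a v = wv v.
  rewrite /restrict_line /WP /eta2_poly /cst bisubstB bisubst_expr -[X in _ - X ^+ 2]/(restrict_line XP a v) xvE.
  rewrite bisubstM bisubstC bisubstD !bisubst_expr !bisubstE /wv -!mul_polyC -/sb.
  by move: sb^-1 (xv v) => s t; ring.
have lineE v : restrict_line (linkage_poly a b a' b' f) a v = ev v ^+ 2 - wv v * ov v ^+ 2.
  rewrite /restrict_line /linkage_poly bisubstB bisubst_expr bisubstM bisubst_expr !bisubst_bicomp.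
  by rewrite -/(restrict_line XP a v) -/(restrict_line WP a v) xvE wvE.
have xv0 v : (xv v).[0] = x0 by rewrite /xv !hornerE.
have wv0 v : (wv v).[0] = - x0 ^+ 2.
  by rewrite /wv hornerD hornerN hornerZ !horner_exp xv0 hornerX expr0n /= mulr0 add0r.
have at0 (p : {poly {poly R}}) v : (bisubst polyC (wv v) (xv v) p).[0] = p.[- x0 ^+ 2, x0].
  rewrite -[LHS]/(horner_eval 0 _) (@bisubst_morph _ _ _ polyC (horner_eval 0) idfun).
    by rewrite bisubst_id /= -/((wv v).[0]) -/((xv v).[0]) /horner_eval wv0 xv0.
  by move=> c; rewrite /= /horner_eval hornerC.
have kf v : ev v ^+ 2 - wv v * ov v ^+ 2 = restrict_line k a v * restrict_line f a v.
  by rewrite -lineE gE restrict_lineM.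
have f0 v : (restrict_line f a v).[0] = 0 by rewrite restrict_lineE along0.
have x02 : 0 < x0 ^+ 2 by rewrite exprn_even_gt0 //= x00.
(* order zero: both parts vanish, since eta2 is negative at a *)
have [E0 O0] : E.[- x0 ^+ 2, x0] = 0 /\ O.[- x0 ^+ 2, x0] = 0.
  have := congr1 (horner^~ 0) (kf 0); rewrite /= hornerD hornerN !hornerM f0 mulr0 !at0 wv0 -!expr2.
  move: E.[_, _] O.[_, _] => u v /eqP; rewrite mulNr opprK paddr_eq0 ?sqr_ge0 //; last first.
    by rewrite mulr_ge0 ?sqr_ge0 // ltW.
  by rewrite sqrf_eq0 mulf_eq0 (gt_eqF x02) sqrf_eq0 => /andP[/eqP -> /eqP ->].
have ev0 v : (ev v).[0] = 0 by rewrite at0.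
have ov0 v : (ov v).[0] = 0 by rewrite at0.
have grad_neq0 : (grad f a).1 ^+ 2 + (grad f a).2 ^+ 2 != 0.
  apply/eqP => /eqP; rewrite paddr_eq0 ?sqr_ge0 // !sqrf_eq0 => /andP[/eqP g1 /eqP g2].
  by apply: crossN; rewrite /cross g1 g2 !mul0r subrr.
have k0 v : (restrict_line k a v).[0] = 0.
  rewrite restrict_lineE along0; have := congr1 (fun p : {poly R} => p^`().[0]) (kf (grad f a)).
  rewrite /= derivB !derivM !(hornerD, hornerN, hornerM) f0 ev0 ov0.
  rewrite !(mulr0, mul0r, addr0, subr0, oppr0) deriv_restrict_line0 restrict_lineE along0.
  by rewrite add0r => /esym/eqP; rewrite mulf_eq0 -!expr2 (negPf grad_neq0) orbF => /eqP.
pose v := (- (grad f a).2, (grad f a).1).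
have df0 : (restrict_line f a v)^`().[0] = 0.
  by rewrite deriv_restrict_line0 /v /=; ring.
have l0 : l v != 0.
  rewrite mulf_neq0 ?invr_neq0 //; apply/eqP => E'; apply: crossN.
  by rewrite -[RHS]E' /v /cross /=; ring.
have [dE dO] : (ev v)^`().[0] = 0 /\ (ov v)^`().[0] = 0.
  have dd_lhs (x y z : {poly R}) : x.[0] = 0 -> y.[0] = 0 ->
      (x ^+ 2 - z * y ^+ 2)^`()^`().[0] = 2 * x^`().[0] ^+ 2 - 2 * z.[0] * y^`().[0] ^+ 2.
    move=> x_0 y_0; rewrite !expr2 !(derivB, derivD, derivN, derivM).
    by rewrite !(hornerD, hornerN, hornerM) x_0 y_0; ring.
  have dd_rhs (x y : {poly R}) : x.[0] = 0 -> y.[0] = 0 -> y^`().[0] = 0 ->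
      (x * y)^`()^`().[0] = 0.
    move=> x_0 y_0 dy_0; rewrite !(derivD, derivM).
    by rewrite !(hornerD, hornerM) x_0 y_0 dy_0; ring.
  have := congr1 (fun p : {poly R} => p^`()^`().[0]) (kf v).
  rewrite /= dd_lhs // dd_rhs // wv0.
  move: (ev v)^`().[0] (ov v)^`().[0] => s t E'.
  have : s ^+ 2 + x0 ^+ 2 * t ^+ 2 = 0 by move: E'; nra.
  move/eqP; rewrite paddr_eq0 ?sqr_ge0 //; last by rewrite mulr_ge0 ?sqr_ge0.
  by rewrite sqrf_eq0 mulf_eq0 (gt_eqF x02) sqrf_eq0 => /andP[/eqP -> /eqP ->].
have dxv : (xv v)^`().[0] = l v.
  by rewrite /xv derivD derivC derivZ derivX add0r hornerZ hornerC mulr1.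
have dwv : (wv v)^`().[0] = - (2 * x0) * l v.
  have dsq (c : R) (x : {poly R}) :
      (c *: 'X ^+ 2 - x ^+ 2)^`().[0] = - (2 * x.[0]) * x^`().[0].
    rewrite !expr2 derivB derivZ !derivM derivX !(hornerD, hornerN, hornerM, hornerZ) hornerX.
    by ring.
  by rewrite /wv dsq xv0 dxv.
have first_order (p : {poly {poly R}}) : (bisubst polyC (wv v) (xv v) p)^`().[0] = 0 ->
    - (2 * x0) * p^`().[- x0 ^+ 2, x0] + (derivY p).[- x0 ^+ 2, x0] = 0.
  have -> : (bisubst polyC (wv v) (xv v) p)^`() = bisubst polyC (wv v) (xv v) p^`() * (wv v)^`()
     + bisubst polyC (wv v) (xv v) (derivY p) * (xv v)^`() by exact: (@bisubst_deriv R R idfun).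
  rewrite hornerD !hornerM !at0 dwv dxv => first0; apply: (mulIf l0).
  by rewrite mul0r -[RHS]first0 mulrDl mulrAC [_ * p^`().[_, _]]mulrC mulrA.
exact: (isotropic_tangent_of_frame neq' E0 O0 (first_order _ dE) (first_order _ dO)).
Qed.

End IsotropicTangent.
End Tangency.

(** * Exceptional points *)

Lemma deriv_eq0_size (S : nzRingType) (p : {poly S}) :
  (forall (c : S) n, c *+ n.+1 = 0 -> c = 0) -> p^`() = 0 -> (size p <= 1)%N.
Proof.
move=> char0 dp; apply/leq_sizeP => -[|j] // _.
by apply: (char0 _ j); rewrite -coef_deriv dp coef0.
Qed.

Section Exceptional.
Variables (R : realType) (d : nat) (f : {poly {poly R}}).
Hypotheses (d_gt0 : (0 < d)%N) (irr_f : irreducible_elt f) (deg_f : bideg_le d f).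
Hypotheses (not_line : ~ real_line (on_curve f)) (not_circle : ~ real_circle (on_curve f)).
Local Notation K := (K_of d).
Local Notation C := (on_curve f).
Hypothesis many : ~ covered (K + K) C.

Lemma many1 : ~ covered K C.
Proof. by move=> cov; apply: many; apply: covered_sub cov => //; rewrite leq_addr. Qed.

Lemma charR0 (c : R) n : c *+ n.+1 = 0 -> c = 0.
Proof. by move/eqP; rewrite mulrn_eq0 /= => /eqP. Qed.

Lemma charRX0 (c : {poly R}) n : c *+ n.+1 = 0 -> c = 0.
Proof. by move=> E; apply/polyP => i; rewrite coef0; apply: (@charR0 _ n); rewrite -coefMn E coef0. Qed.

Lemma not_multiple_deriv (p : {poly {poly R}}) k : p != 0 -> p^`() = k * p -> p^`() = 0.
Proof.
move=> p0 E; apply/eqP; apply: contraT => dp0.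
have k0 : k != 0 by apply: contra_neq dp0 => k0; rewrite E k0 mul0r.
have := lt_size_deriv p0; rewrite E size_mul //.
by have := size_poly_gt0 k; rewrite k0; case: (size k) => // n _; rewrite addSn /= ltnNge leq_addl.
Qed.

Definition grad_sq : {poly {poly R}} := f^`() ^+ 2 + derivY f ^+ 2.

Lemma grad_sqE q : grad_sq.[q.1, q.2] = (grad f q).1 ^+ 2 + (grad f q).2 ^+ 2.
Proof. by rewrite /grad_sq /grad !(hornerD, horner_exp). Qed.

Lemma bideg_grad_sq : bideg_le (2 * d) grad_sq.
Proof.
by apply: bideg_leD_same; apply: bideg_leXn; [exact: bideg_le_deriv|exact: bideg_le_derivY].
Qed.

(** If f divided the squared gradient, both partial derivatives would vanish on C. As they have
    smaller degree than f in one variable, they would be zero, and f would be constant. *)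
Lemma grad_sq_not_multiple : ~ (exists k, grad_sq = k * f).
Proof.
move=> [k kE]; have [f0 fU _] := irr_f.
have grad0 q : C q -> on_curve f^`() q /\ on_curve (derivY f) q.
  move=> /(multiple_vanishes kE); rewrite /on_curve grad_sqE => /eqP.
  rewrite paddr_eq0 ?sqr_ge0 // !sqrf_eq0 => /andP[/eqP gx /eqP gy].
  by split; [exact: gx | exact: gy].
have dX0 : f^`() = 0.
  have [|[k' k'E]|cov] := bezout irr_f deg_f (bideg_le_deriv deg_f); first lia.
    exact: not_multiple_deriv k'E.
  by case: many1; apply: covered_sub cov => // q Cq; case: (grad0 q Cq).
have dY0 : (swapXY f)^`() = 0.
  have [|[k' k'E]|cov] := bezout irr_f deg_f (bideg_le_derivY deg_f); first lia.
    apply: (@not_multiple_deriv _ (swapXY k')); first by rewrite swapXY_eq0.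
    by rewrite -[RHS](rmorphM swapXY) -k'E /derivY /= swapXYK.
  by case: many1; apply: covered_sub cov => // q Cq; case: (grad0 q Cq).
have fE := size1_polyC (deriv_eq0_size charRX0 dX0).
have c1 : (size (f`_0)%R <= 1)%N.
  apply: deriv_eq0_size charR0 _; apply/eqP; rewrite -map_polyC_eq0 -deriv_map -swapXY_polyC.
  by rewrite -fE dY0.
move: fU; rewrite fE poly_unitE coefC eqxx size_polyC.
have c0 : f`_0 != 0 by apply: contra_neq f0 => c0; rewrite fE c0.
rewrite c0 eqxx /= poly_unitE => /negP; apply.
rewrite eqn_leq c1 size_poly_gt0 c0 /= unitfE.
by apply: contra_neq c0 => c00; rewrite (size1_polyC c1) c00.
Qed.

Lemma singular_covered : covered K (fun q => C q /\ grad f q = 0).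
Proof.
have [|//|cov] := bezout irr_f deg_f bideg_grad_sq; first lia.
  by move/grad_sq_not_multiple.
apply: covered_sub cov => // q [Cq gq]; split=> //.
by rewrite /on_curve grad_sqE gq !expr0n addr0.
Qed.

(** At a point of tangency (f_x + i f_y) (f_x - i f_y) = 0, so the complex points of tangency are
    common zeros of f and [grad_sq]; each determines a by a.1 + i a.2 = z.1 + i z.2. *)
Lemma isotropic_covered :
  covered K (fun a => isotropic_tangent (real_complex R) 'i%C f a).
Proof.
have := common_zeros_covered (real_complex R) irr_f deg_f bideg_grad_sq grad_sq_not_multiple.
move/(covered_image (fun z => let w := (z.1 + 'i%C * z.2)%R in (complex.Re w, complex.Im w))).
apply: covered_sub; first by apply: common_bound_mono; lia.
move=> a [z [fz dfz zE]]; exists z.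
  split=> //; rewrite /grad_sq bisubstD !bisubst_expr.
  transitivity ((bisubst (real_complex R) z.1 z.2 f^`() + 'i%C * bisubst (real_complex R) z.1 z.2 (derivY f))
     * (bisubst (real_complex R) z.1 z.2 f^`() - 'i%C * bisubst (real_complex R) z.1 z.2 (derivY f))).
    by rewrite mulrC -subr_sqr exprMn sqr_i mulN1r opprK.
  by rewrite dfz mul0r.
rewrite /= zE; case: a {zE} => a1 a2 /=.
by congr (_, _); rewrite ?(mul0r, mul1r, mulr0, subr0, addr0, add0r).
Qed.

(** Its zeros on C are the critical points of the distance to p. *)
Definition spin_poly (p : R * R) : {poly {poly R}} :=
  f^`() * ('Y - cst p.2) - derivY f * ('X - cst p.1).

Lemma spin_polyE p q : (spin_poly p).[q.1, q.2] = cross (grad f q) (q - p).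
Proof.
by rewrite -bisubst_id /spin_poly /cst !bisubstE !bisubst_id.
Qed.

Lemma bideg_spin_poly p : bideg_le (d + 1) (spin_poly p).
Proof.
by apply: bideg_leD_same; rewrite ?bideg_leN; apply: bideg_leM;
  rewrite ?bideg_le_deriv ?bideg_le_derivY //; apply: bideg_leD_same;
  rewrite ?bideg_leN ?bideg_cst ?bideg_leX ?bideg_leY.
Qed.

(** The difference of two such polynomials is, up to sign, the derivative of f in the direction v
    orthogonal to the segment between the centres. If f divided both, the restriction of f to a line
    of direction v would divide its own derivative and be constant, so C would contain such a line. *)
Lemma spin_center_covered : covered 1 (fun p => exists k, spin_poly p = k * f).
Proof.
have [[p [k kE]]|none] := pselect (exists p, exists k, spin_poly p = k * f); last first.
  by exists [::]; split=> // p kp; case: none; exists p.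
exists [:: p]; split=> // p' [k' k'E]; rewrite inE; apply/eqP; apply: contrapT => pp'.
have [q Cq] : exists q, C q.
  apply: contrapT => none; apply: many1; exists [::]; split=> // q Cq; case: none; by exists q.
pose v : R * R := (p.2 - p'.2, p'.1 - p.1).
have v0 : v <> 0.
  move=> [E1 E2]; apply: pp'; case: (p) (p') E1 E2 => [x y] [x' y'] /= E1 E2.
  by congr (_, _); lra.
pose P := restrict_line f q v.
have dP : P^`() = restrict_line (k' - k) q v * P.
  rewrite -restrict_lineM mulrBl -kE -k'E deriv_restrict_line.
  rewrite /restrict_line /spin_poly /cst !bisubstE -!mul_polyC /v /=.
  by rewrite !polyCB; ring.
have P0 t : P.[t] = 0.
  have [->|Pn0] := eqVneq P 0; first by rewrite horner0.
  have dP0 : P^`() = 0.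
    apply/eqP; apply: contraT => dPn0.
    set r := restrict_line _ q v in dP.
    have r0 : r != 0 by apply: contra_neq dPn0 => r0; rewrite dP r0 mul0r.
    have := lt_size_deriv Pn0; rewrite dP size_mul //.
    by have := size_poly_gt0 r; rewrite r0; case: (size r) => // n _; rewrite addSn /= ltnNge leq_addl.
  have PE := size1_polyC (deriv_eq0_size charR0 dP0).
  have : P.[0] = 0 by rewrite restrict_lineE along0.
  by rewrite PE !hornerC.
apply: (no_line d_gt0 irr_f deg_f not_line (q := q) v0) => m.
by rewrite /on_curve -restrict_lineE P0.
Qed.

(** The composition of f with an affine map has bounded degree, so a Bezout argument applies to
    tau, and to its inverse. *)
Lemma preserves_of_many (tau tau' : R * R -> R * R) (P Q P' Q' : {poly {poly R}}) :
  bideg_le 1 P -> bideg_le 1 Q -> bideg_le 1 P' -> bideg_le 1 Q' ->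
  (forall q, tau q = (P.[q.1, q.2], Q.[q.1, q.2])) ->
  (forall q, tau' q = (P'.[q.1, q.2], Q'.[q.1, q.2])) ->
  cancel tau tau' -> cancel tau' tau ->
  ~ covered K (fun q => C q /\ C (tau q)) -> preserves C tau.
Proof.
move=> bP bQ bP' bQ' tauE tau'E tauK tau'K ncov.
have pull (s : R * R -> R * R) (S T : {poly {poly R}}) : bideg_le 1 S -> bideg_le 1 T ->
    (forall q, s q = (S.[q.1, q.2], T.[q.1, q.2])) ->
    ~ covered K (fun q => C q /\ C (s q)) -> forall q, C q -> C (s q).
  move=> bS bT sE ncov' q Cq.
  have sC x : C (s x) <-> on_curve (bicomp f S T) x by rewrite /on_curve bicompE sE.
  have [||[k kE]|cov] := bezout irr_f deg_f (e := 2 * d * 1) (g := bicomp f S T).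
  - exact: bideg_le_comp.
  - lia.
  - by apply/sC; apply: multiple_vanishes kE Cq.
  - by case: ncov'; apply: covered_sub cov => // x [Cx /sC].
have fwd := pull tau P Q bP bQ tauE ncov.
move=> q; split; last exact: fwd.
move=> Ctq; rewrite -[q]tauK; apply: (pull tau' P' Q') => // cov.
apply: ncov; apply: covered_sub (covered_image tau' cov) => // x [Cx Ctx].
by exists (tau x); rewrite ?tauK.
Qed.

End Exceptional.

(** * Common curves of two grid points *)

Section Multiplicity.
Variables (R : realType) (d : nat) (f : {poly {poly R}}).
Hypotheses (d_gt0 : (0 < d)%N) (irr_f : irreducible_elt f) (deg_f : bideg_le d f).
Hypotheses (not_line : ~ real_line (on_curve f)) (not_circle : ~ real_circle (on_curve f)).
Local Notation K := (K_of d).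
Local Notation C := (on_curve f).
Hypothesis many : ~ covered (K + K) C.
Implicit Types (a b p q s t : R * R).

Lemma rotation_preserves (c s : R) w : c ^+ 2 + s ^+ 2 = 1 ->
  ~ covered K (fun q => C q /\ C (rotation c s w q)) -> preserves C (rotation c s w).
Proof.
move=> cs; pose w' : R * R := (- (c * w.1 + s * w.2), s * w.1 - c * w.2).
have bl (x y z : R) : bideg_le 1 (cst x * 'X + cst y * 'Y + cst z).
  by apply: bideg_leD_same; last exact: bideg_cst; apply: bideg_leD_same;
    apply: (@bideg_leM _ 0 1); rewrite ?bideg_cst ?bideg_leX ?bideg_leY.
apply: (@preserves_of_many _ _ _ d_gt0 irr_f deg_f _ (rotation c (- s) w')
  (cst c * 'X + cst (- s) * 'Y + cst w.1) (cst s * 'X + cst c * 'Y + cst w.2)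
  (cst c * 'X + cst s * 'Y + cst w'.1) (cst (- s) * 'X + cst c * 'Y + cst w'.2)) => //.
- by move=> q; rewrite -!bisubst_id /cst !bisubstE /rotation /= mulNr.
- by move=> q; rewrite -!bisubst_id /cst !bisubstE /rotation /= !mulNr opprK.
- move=> [x y]; rewrite /rotation /w' /=; congr (_, _).
    by transitivity ((c ^+ 2 + s ^+ 2) * x); [ring|rewrite cs mul1r].
  by transitivity ((c ^+ 2 + s ^+ 2) * y); [ring|rewrite cs mul1r].
- move=> [x y]; rewrite /rotation /w' /=; congr (_, _).
    by transitivity ((c ^+ 2 + s ^+ 2) * (x - w.1) + w.1); [ring|rewrite cs; ring].
  by transitivity ((c ^+ 2 + s ^+ 2) * (y - w.2) + w.2); [ring|rewrite cs; ring].
Qed.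

Lemma reflection_preserves (c s : R) w : c ^+ 2 + s ^+ 2 = 1 ->
  ~ covered K (fun q => C q /\ C (reflection c s w q)) -> preserves C (reflection c s w).
Proof.
move=> cs; pose w' : R * R := (- (c * w.1 + s * w.2), c * w.2 - s * w.1).
have bl (x y z : R) : bideg_le 1 (cst x * 'X + cst y * 'Y + cst z).
  by apply: bideg_leD_same; last exact: bideg_cst; apply: bideg_leD_same;
    apply: (@bideg_leM _ 0 1); rewrite ?bideg_cst ?bideg_leX ?bideg_leY.
apply: (@preserves_of_many _ _ _ d_gt0 irr_f deg_f _ (reflection c s w')
  (cst c * 'X + cst s * 'Y + cst w.1) (cst s * 'X + cst (- c) * 'Y + cst w.2)
  (cst c * 'X + cst s * 'Y + cst w'.1) (cst s * 'X + cst (- c) * 'Y + cst w'.2)) => //.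
- by move=> q; rewrite -!bisubst_id /cst !bisubstE /reflection /= mulNr.
- by move=> q; rewrite -!bisubst_id /cst !bisubstE /reflection /= mulNr.
- move=> [x y]; rewrite /reflection /w' /=; congr (_, _).
    by transitivity ((c ^+ 2 + s ^+ 2) * x); [ring|rewrite cs mul1r].
  by transitivity ((c ^+ 2 + s ^+ 2) * y); [ring|rewrite cs mul1r].
- move=> [x y]; rewrite /reflection /w' /=; congr (_, _).
    by transitivity ((c ^+ 2 + s ^+ 2) * (x - w.1) + w.1); [ring|rewrite cs; ring].
  by transitivity ((c ^+ 2 + s ^+ 2) * (y - w.2) + w.2); [ring|rewrite cs; ring].
Qed.

(** Some isometry of the plane that preserves C maps p to q. *)
Definition symmetric_pair p q : Prop := rotation_image C p q \/ reflection_image C p q.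

Lemma symmetric_covered p : C p -> covered (K + K) (symmetric_pair p).
Proof.
move=> Cp; apply: covered_or.
  exact: (rotation_images_covered d_gt0 irr_f deg_f not_line not_circle).
exact: (reflection_images_covered d_gt0 irr_f deg_f not_line not_circle).
Qed.

(** When |ab| = |a'b'|, the two candidates for p' are the images of p under the two isometries that
    send a to a' and b to b'. If f divides the product of f over them, then one of the two sends
    many points of C into C. *)
Lemma linkage_multiple_symmetric k a b a' b' :
  a' <> b' -> sqd a b = sqd a' b' -> linkage_poly a b a' b' f = k * f ->
  symmetric_pair a a'.
Proof.
move=> neq' eqd gE; have sb0 := sb_neq0 neq'; set sb := sqd a' b' in eqd sb0.
pose u : R * R := (b.1 - a.1, b.2 - a.2); pose e : R * R := (b'.1 - a'.1, b'.2 - a'.2).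
have su : u.1 ^+ 2 + u.2 ^+ 2 = sb by rewrite -eqd /sqd /u /=; ring.
have se : e.1 ^+ 2 + e.2 ^+ 2 = sb by rewrite /sb /sqd /e /=; ring.
have unit_div x y : x ^+ 2 + y ^+ 2 = sb ^+ 2 -> (x / sb) ^+ 2 + (y / sb) ^+ 2 = 1.
  by move=> E; rewrite !expr_div_n -mulrDl E divff // sqrf_eq0.
have sq2 : sb ^+ 2 = (u.1 ^+ 2 + u.2 ^+ 2) * (e.1 ^+ 2 + e.2 ^+ 2) by rewrite su se.
(* the two isometries that send the segment a b to the segment a' b' *)
pose cp := (u.1 * e.1 + u.2 * e.2) / sb; pose sp := (u.1 * e.2 - u.2 * e.1) / sb.
pose cm := (u.1 * e.1 - u.2 * e.2) / sb; pose sm := (u.1 * e.2 + u.2 * e.1) / sb.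
have csp : cp ^+ 2 + sp ^+ 2 = 1 by apply: unit_div; rewrite sq2; ring.
have csm : cm ^+ 2 + sm ^+ 2 = 1 by apply: unit_div; rewrite sq2; ring.
pose wp : R * R := (a'.1 - (cp * a.1 - sp * a.2), a'.2 - (sp * a.1 + cp * a.2)).
pose wm : R * R := (a'.1 - (cm * a.1 + sm * a.2), a'.2 - (sm * a.1 - cm * a.2)).
pose xi0 p := ((p.1 - a.1) * u.1 + (p.2 - a.2) * u.2) / sb.
pose eta p := ((p.2 - a.2) * u.1 - (p.1 - a.1) * u.2) / sb.
have xiE p : xi a b a' b' p = xi0 p.
  rewrite /xi -/sb eqd subrK /xi0 /u /=; field.
  by rewrite sb0.
have etaE p : eta p ^+ 2 = eta2 a b a' b' p.
  rewrite /eta2 xiE /eta /xi0 !expr_div_n -/sb.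
  have -> : ((p.2 - a.2) * u.1 - (p.1 - a.1) * u.2) ^+ 2 =
     sqd p a * sb - ((p.1 - a.1) * u.1 + (p.2 - a.2) * u.2) ^+ 2.
    by rewrite -su /sqd; ring.
  by field.
have Ep p : (in_frame f a' b').[eta p, xi a b a' b' p] = 0 -> C (rotation cp sp wp p).
  rewrite xiE -[X in X = _]bisubst_id bisubst_in_frame /= bisubst_id => E.
  rewrite /on_curve -[RHS]E; congr (_.[_, _]); rewrite /= /wp /cp /sp /eta /xi0 /e /=;
    by field.
have Em p : (in_frame f a' b').[- eta p, xi a b a' b' p] = 0 -> C (reflection cm sm wm p).
  rewrite xiE -[X in X = _]bisubst_id bisubst_in_frame /= bisubst_id => E.
  rewrite /on_curve -[RHS]E; congr (_.[_, _]); rewrite /= /wm /cm /sm /eta /xi0 /e /=;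
    by field.
have [covp|ncovp] := pselect (covered K (fun q => C q /\ C (rotation cp sp wp q))); last first.
  left; exists cp, sp, wp; split=> //; first exact: rotation_preserves.
  by rewrite /rotation /wp /=; case: (a') => x y /=; congr (_, _); ring.
have [covm|ncovm] := pselect (covered K (fun q => C q /\ C (reflection cm sm wm q))); last first.
  right; exists cm, sm, wm; split=> //; first exact: reflection_preserves.
  by rewrite /reflection /wm /=; case: (a') => x y /=; congr (_, _); ring.
case: many; apply: covered_sub (covered_or covp covm) => // q Cq.
have := multiple_vanishes gE Cq; rewrite /on_curve (linkage_polyE_sq neq' f (etaE q)) => /eqP.
by rewrite mulf_eq0 => /orP[/eqP/Ep|/eqP/Em]; [left|right].
Qed.

Definition double_normal a b : Prop :=
  cross (grad f a) (b - a) = 0 /\ cross (grad f b) (a - b) = 0.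

Definition isotropic_point a : Prop := isotropic_tangent (real_complex R) 'i%C f a.

(** The centres (p, p') of the curves |p q| = |p' q'| through both (a, a') and (b, b'). *)
Definition equidistant a b a' b' (z : (R * R) * (R * R)) : Prop :=
  [/\ C z.1, C z.2, sqd z.1 a = sqd z.2 a' & sqd z.1 b = sqd z.2 b'].

Lemma equidistant_covered_aux a b a' b' :
  C a -> a' <> b' -> ~ isotropic_point a' -> ~ symmetric_pair a a' ->
  cross (grad f a) (b - a) <> 0 ->
  covered (K * K) (equidistant a b a' b').
Proof.
move=> Ca neq' niso nsym crossN.
have bg := bideg_linkage_poly a b a' b' deg_f.
have [|[k kE]|cov] := bezout irr_f deg_f bg; first by lia.
  have [eqd|neqd] := pselect (sqd a b = sqd a' b').
    by case: nsym; exact: linkage_multiple_symmetric eqd kE.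
  have i2 := sqr_i R.
  have := linkage_multiple_isotropic (real_complex R) i2 neq' neqd Ca kE crossN.
  by move/niso.
have circ p : C p /\ on_curve (linkage_poly a b a' b' f) p ->
    covered K (fun p' => C p' /\ sqd p' a' = sqd p a).
  by move=> _; apply: (circle_covered d_gt0 irr_f deg_f not_circle).
apply: covered_sub (covered_pair cov circ) => // -[p p'] [/= Cp Cp' pa pb].
by split; split=> //; exact: linkage_poly_zero pa pb Cp'.
Qed.

Lemma bisector_covered t t' : t <> t' ->
  covered K (fun q => C q /\ sqd q t = sqd q t').
Proof.
move=> tt'; pose v : R * R := (t.2 - t'.2, t'.1 - t.1).
pose m : R * R := ((t.1 + t'.1) / 2, (t.2 + t'.2) / 2).
have v0 : v <> 0.
  move=> [E1 E2]; apply: tt'; case: (t) (t') E1 E2 => [x y] [x' y'] /= E1 E2.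
  by congr (_, _); lra.
apply: covered_sub (line_covered d_gt0 irr_f deg_f not_line m v0) => // q [Cq].
by rewrite /sqd => E; split=> //; rewrite /cross /v /m /=; lra.
Qed.

(** The roles of (a, a') and (b, b') may be exchanged, so it is enough that ab is not normal to C at
    one end. When a = b or a' = b' one of the centres lies on a perpendicular bisector. *)
Lemma equidistant_covered a b a' b' :
  C a -> C b -> ~ isotropic_point a' -> ~ isotropic_point b' ->
  ~ symmetric_pair a a' -> ~ symmetric_pair b b' -> ~ (a <> b /\ double_normal a b) ->
  (a, a') <> (b, b') ->
  covered (K * K) (equidistant a b a' b').
Proof.
move=> Ca Cb na' nb' nsa nsb ndn neq.
have circ o r : covered K (fun q => C q /\ sqd q o = r).
  exact: (circle_covered d_gt0 irr_f deg_f not_circle).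
have [ab|ab] := pselect (a = b).
  have ab' : a' <> b' by move=> ab'; apply: neq; rewrite ab ab'.
  have := covered_pair (bisector_covered ab') (fun q _ => circ a (sqd q a')).
  move/(covered_image (fun z => (z.2, z.1))); apply: covered_sub => // -[p p'] [/= Cp Cp' pa pb].
  by exists (p', p) => //=; split; split=> //; rewrite -pa -pb ab.
have [ab'|ab'] := pselect (a' = b').
  have := covered_pair (bisector_covered ab) (fun q _ => circ a' (sqd q a)).
  apply: covered_sub => // -[p p'] [/= Cp Cp' pa pb].
  by split; split=> //; rewrite pa pb ab'.
have [cab|cab] := pselect (cross (grad f a) (b - a) = 0); last first.
  exact: equidistant_covered_aux.
have cba : cross (grad f b) (a - b) <> 0 by move=> cba; apply: ndn.
have := @equidistant_covered_aux b a b' a' Cb (fun E => ab' (esym E)) nb' nsb cba.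
by apply: covered_sub => // z [Cp Cp' pa pb].
Qed.

End Multiplicity.

(** * Descending towards a centre along the curve *)

Section Continuity.
Variables (R : realType) (T : topologicalType).
Implicit Types (F G : T -> R).

Lemma continuous_add F G : continuous F -> continuous G -> continuous (fun t => F t + G t).
Proof. by move=> cF cG t; apply: cvgD; [exact: cF | exact: cG]. Qed.

Lemma continuous_mul F G : continuous F -> continuous G -> continuous (fun t => F t * G t).
Proof. by move=> cF cG t; apply: cvgM; [exact: cF | exact: cG]. Qed.

Lemma continuous_opp F : continuous F -> continuous (fun t => - F t).
Proof. by move=> cF t; apply: cvgN; exact: cF. Qed.

Lemma continuous_const (c : R) : continuous (fun _ : T => c).
Proof. by move=> t; exact: cvg_cst. Qed.

Lemma continuous_inv F : (forall t, F t != 0) -> continuous F -> continuous (fun t => (F t)^-1).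
Proof. by move=> F0 cF t; apply: cvgV; [exact: F0 | exact: cF]. Qed.

Lemma continuous_bipoly (p : {poly {poly R}}) F G :
  continuous F -> continuous G -> continuous (fun t => p.[F t, G t]).
Proof.
move=> cF cG; elim/bipoly_ind: p => [c|||p q cp cq|p q cp cq].
- by under eq_fun do rewrite !hornerC; exact: continuous_const.
- by under eq_fun do rewrite hornerX hornerC.
- by under eq_fun do rewrite hornerC hornerX.
- by under eq_fun do rewrite !hornerD; exact: continuous_add.
- by under eq_fun do rewrite !hornerM; exact: continuous_mul.
Qed.

End Continuity.

Section Descent.
Variables (R : realType) (f : {poly {poly R}}).
Local Notation C := (on_curve f).
Implicit Types (p q : R * R).

(** An exact first-order expansion whose coefficients are polynomials, hence continuous. *)
Lemma first_order_expansion (g : {poly {poly R}}) q : exists A B : {poly {poly R}},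
  [/\ forall u v, g.[q.1 + u, q.2 + v] = g.[q.1, q.2] + u * A.[u, v] + v * B.[u, v],
      A.[0, 0] = (grad g q).1 & B.[0, 0] = (grad g q).2].
Proof.
rewrite /grad /=; elim/bipoly_ind: g => [c|||g h [A [B [gE gA gB]]] [A' [B' [hE hA hB]]]|
   g h [A [B [gE gA gB]]] [A' [B' [hE hA hB]]]].
- exists 0, 0; rewrite derivC derivYC !horner0.
  by split=> // u v; rewrite !horner0 !mulr0 !addr0 !hornerC.
- exists 1, 0; rewrite derivX derivYX !horner0.
  split=> [u v||//]; last by rewrite !hornerC.
  by rewrite !horner0 !hornerX !hornerC mulr0 mulr1 addr0.
- exists 0, 1; rewrite derivC derivYY !horner0.
  split=> [u v|//|]; last by rewrite !hornerC.
  by rewrite !horner0 !hornerC !hornerX ?hornerC mulr0 mulr1 addr0.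
- exists (A + A'), (B + B'); rewrite derivD derivYD; split=> [u v||].
  + by rewrite !hornerD gE hE; ring.
  + by rewrite !hornerD gA hA.
  + by rewrite !hornerD gB hB.
- pose hs := bicomp h (cst q.1 + 'X) (cst q.2 + 'Y).
  have hsE u v : hs.[u, v] = h.[q.1 + u, q.2 + v].
    by rewrite /hs bicompE /cst !hornerE.
  exists (A * hs + cst g.[q.1, q.2] * A'), (B * hs + cst g.[q.1, q.2] * B').
  rewrite derivM derivYM; split=> [u v||].
  + rewrite !(hornerD, hornerM) hsE /cst !hornerC hE gE; ring.
  + by rewrite !(hornerD, hornerM) hsE /cst !hornerC gA hA !addr0.
  + by rewrite !(hornerD, hornerM) hsE /cst !hornerC gB hB !addr0.
Qed.

Lemma near_same_sign (h : R -> R) x : continuous h -> h x != 0 ->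
  exists2 e : R, 0 < e & forall y, `|y - x| < e -> 0 < h y * h x.
Proof.
move=> ch hx0; have pos : 0 < `|h x| by rewrite normr_gt0.
have /cvgrPdist_lt /(_ _ pos) /nbhs_ballP [e /= e0 eP] := ch x.
exists e => // y yx; have := eP y; rewrite /ball /= distrC => /(_ yx).
by have [hp|hn|h0] := ltgtP 0 (h x); rewrite ?(gtr0_norm hp) ?(ltr0_norm hn) ?ltr_norml;
  [nra|nra|rewrite -h0 eqxx in hx0].
Qed.

Lemma opposite_signs (u v : R) : u * v < 0 -> Num.min v u <= 0 <= Num.max v u.
Proof.
move=> uv; rewrite ge_min le_max; case: (ltgtP u 0) uv => [u0|u0|->]; last by rewrite mul0r ltxx.
- by rewrite nmulr_rlt0 // => /ltW ->; rewrite orbT.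
- by rewrite pmulr_rlt0 // => /ltW ->; rewrite orbT.
Qed.

(** The curve crosses the circles about p transversally at a point q that is not critical. Thus f
    changes sign along a small arc through q of the circle about p; by continuity it still does
    along the arcs of slightly smaller radius, which contain a zero of f close to q. *)
Lemma descent p q (x1 x2 : R) : C q -> cross (grad f q) (q - p) <> 0 -> x1 < q.1 < x2 ->
  exists2 e : R, 0 < e & forall r, sqd q p - e < r -> r <= sqd q p ->
    exists q', [/\ C q', sqd q' p = r & x1 < q'.1 < x2].
Proof.
move=> Cq crossN /andP[x1q qx2].
pose D1 := q.1 - p.1; pose D2 := q.2 - p.2; pose rho := sqd q p.
have crossE : cross (grad f q) (q - p) = (grad f q).1 * D2 - (grad f q).2 * D1 by [].
have rho_gt0 : 0 < rho.
  rewrite lt_neqAle sqd_ge0 andbT eq_sym; apply/eqP => /sqd_eq0 qp.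
  by apply: crossN; rewrite crossE /D1 /D2 qp !subrr !mulr0 subr0.
have den (t : R) : 1 + t ^+ 2 != 0 by rewrite gt_eqF // ltr_pwDl // sqr_ge0.
(* The rational parametrization of the rotations, and the images of q under the rotation with
   parameter t about p followed by the homothety of ratio k. *)
pose c (t : R) := (1 - t ^+ 2) * (1 + t ^+ 2)^-1.
pose s (t : R) := (2 * t) * (1 + t ^+ 2)^-1.
have cid : continuous (fun t : R => t) by move=> t; exact: cvg_id.
have csq : continuous (fun t : R => t ^+ 2).
  by under eq_fun do rewrite expr2; exact: continuous_mul.
have cden : continuous (fun t : R => (1 + t ^+ 2)^-1).
  by apply: continuous_inv => //; apply: continuous_add => //; exact: continuous_const.
have cc : continuous c.
  apply: continuous_mul => //; apply: continuous_add; first exact: continuous_const.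
  exact: continuous_opp.
have cs : continuous s.
  by apply: continuous_mul => //; apply: continuous_mul => //; exact: continuous_const.
have csE t : c t ^+ 2 + s t ^+ 2 = 1 by rewrite /c /s; field; exact: den.
pose X (k t : R) := p.1 + k * (c t * D1 - s t * D2).
pose Y (k t : R) := p.2 + k * (s t * D1 + c t * D2).
have sqdXY k t : sqd (X k t, Y k t) p = k ^+ 2 * rho.
  rewrite /sqd /X /Y /= /rho /sqd -/D1 -/D2.
  transitivity (k ^+ 2 * ((c t ^+ 2 + s t ^+ 2) * (D1 ^+ 2 + D2 ^+ 2))); first by ring.
  by rewrite csE mul1r.
have cXt k : continuous (X k).
  apply: continuous_add; first exact: continuous_const.
  apply: continuous_mul; first exact: continuous_const.
  apply: continuous_add; last apply: continuous_opp;
    by apply: continuous_mul => //; exact: continuous_const.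
have cYt k : continuous (Y k).
  apply: continuous_add; first exact: continuous_const.
  apply: continuous_mul; first exact: continuous_const.
  by apply: continuous_add; apply: continuous_mul => //; exact: continuous_const.
have cXk t : continuous (X^~ t).
  apply: continuous_add; first exact: continuous_const.
  by apply: continuous_mul => //; exact: continuous_const.
have cYk t : continuous (Y^~ t).
  apply: continuous_add; first exact: continuous_const.
  by apply: continuous_mul => //; exact: continuous_const.
have cX2 : continuous (fun z : R * R => X z.1 z.2).
  have c2 (h : R -> R) : continuous h -> continuous (fun z : R * R => h z.2).
    by move=> ch z; apply: continuous_comp; [exact: cvg_snd | exact: ch].
  apply: continuous_add; first exact: continuous_const.
  apply: continuous_mul; first by move=> z; exact: cvg_fst.
  apply: continuous_add; last apply: continuous_opp;
    by apply: continuous_mul; [exact: c2 | exact: continuous_const].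
(* f along the circle through q factors as t * G t with G 0 != 0 *)
have [A [B [fE fA fB]]] := first_order_expansion f q.
pose V1 (t : R) := 2 * (1 + t ^+ 2)^-1 * (- t * D1 - D2).
pose V2 (t : R) := 2 * (1 + t ^+ 2)^-1 * (D1 - t * D2).
have cV1 : continuous V1.
  apply: continuous_mul; first by apply: continuous_mul => //; exact: continuous_const.
  apply: continuous_add; last exact: continuous_const.
  by apply: continuous_mul; [exact: continuous_opp | exact: continuous_const].
have cV2 : continuous V2.
  apply: continuous_mul; first by apply: continuous_mul => //; exact: continuous_const.
  apply: continuous_add; first exact: continuous_const.
  by apply: continuous_opp; apply: continuous_mul => //; exact: continuous_const.
have X1E t : X 1 t = q.1 + t * V1 t.
  by rewrite /X /V1 /c /s /D1 /D2; field; exact: den.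
have Y1E t : Y 1 t = q.2 + t * V2 t.
  by rewrite /Y /V2 /c /s /D1 /D2; field; exact: den.
pose G t := V1 t * A.[t * V1 t, t * V2 t] + V2 t * B.[t * V1 t, t * V2 t].
have f1E t : f.[X 1 t, Y 1 t] = t * G t.
  by rewrite X1E Y1E fE [f.[_, _]]Cq add0r /G; ring.
have cG : continuous G.
  by apply: continuous_add; apply: continuous_mul => //; apply: continuous_bipoly;
    apply: continuous_mul.
have G0 : G 0 != 0.
  apply/eqP => E; apply: crossN; move: E.
  rewrite /G !mul0r fA fB /V1 /V2 expr0n addr0 invr1 mulr1 crossE => E.
  by move: E; lra.
have [e1 e1_gt0 e1P] := near_same_sign cG G0.
have [e2 e2_gt0 e2P] : exists2 e : R, 0 < e & forall k t, `|k - 1| < e -> `|t| < e -> x1 < X k t < x2.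
  have X10 : X 1 0 = q.1 by rewrite X1E mul0r addr0.
  pose gap := Num.min (q.1 - x1) (x2 - q.1).
  have gap_gt0 : 0 < gap by rewrite lt_min !subr_gt0 x1q.
  have /cvgrPdist_lt /(_ _ gap_gt0) /nbhs_ballP [e /= e0 eP] := cX2 (1, 0).
  exists e => // k t ke te; have := eP (k, t).
  rewrite /= X10 /gap lt_min !ltr_norml => /(_ _) /andP[|/andP[_ h1] /andP[h2 _]].
    by split; rewrite /= /ball /= ?sub0r ?normrN // distrC.
  by apply/andP; split; lra.
pose t0 := Num.min e1 e2 / 2.
have m_gt0 : 0 < Num.min e1 e2 by rewrite lt_min e1_gt0.
have t0_gt0 : 0 < t0 by rewrite divr_gt0.
have t0_lt : t0 < Num.min e1 e2 by rewrite /t0; lra.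
have /andP[t0e1 t0e2] : (t0 < e1) && (t0 < e2) by rewrite -lt_min.
have opposite : f.[X 1 t0, Y 1 t0] * f.[X 1 (- t0), Y 1 (- t0)] < 0.
  rewrite !f1E; have := e1P t0; have := e1P (- t0).
  rewrite !subr0 normrN gtr0_norm // => /(_ t0e1) Gm /(_ t0e1) Gp.
  have : 0 < G t0 * G (- t0).
    have : 0 < (G t0 * G 0) * (G (- t0) * G 0) by rewrite mulr_gt0.
    have -> : (G t0 * G 0) * (G (- t0) * G 0) = (G t0 * G (- t0)) * G 0 ^+ 2 by ring.
    by rewrite pmulr_lgt0 // exprn_even_gt0 //= G0.
  have -> : t0 * G t0 * (- t0 * G (- t0)) = - (t0 ^+ 2 * (G t0 * G (- t0))) by ring.
  by move=> ?; rewrite oppr_lt0 mulr_gt0 // exprn_gt0.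
pose H k := f.[X k t0, Y k t0] * f.[X k (- t0), Y k (- t0)].
have cH : continuous H by apply: continuous_mul; apply: continuous_bipoly.
have [e3 e3_gt0 e3P] := near_same_sign cH (ltr0_neq0 opposite).
pose eta := Num.min (Num.min e2 e3) 1.
have eta_gt0 : 0 < eta by rewrite !lt_min e2_gt0 e3_gt0 ltr01.
exists (eta * rho); first by rewrite mulr_gt0.
rewrite -/rho => r r_gt r_le.
have eta_le1 : eta <= 1 by rewrite ge_min lexx orbT.
have r_gt0 : 0 < r by apply: le_lt_trans r_gt; nra.
pose k := Num.sqrt (r / rho).
have k2 : k ^+ 2 = r / rho by rewrite sqr_sqrtr // divr_ge0 // ltW.
have k_ge0 : 0 <= k by exact: sqrtr_ge0.
have k_le1 : k <= 1 by rewrite -sqrtr1 ler_wsqrtr // ler_pdivrMr // mul1r.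
have k_gt : 1 - eta < k.
  have : 1 - eta < k ^+ 2 by rewrite k2 ltr_pdivlMr // mulrBl mul1r.
  by move/lt_le_trans; apply; nra.
have k1 : `|k - 1| < eta by rewrite ltr_norml; apply/andP; split; lra.
have k1e2 : `|k - 1| < e2 by apply: (lt_le_trans k1); rewrite /eta !ge_min lexx.
have k1e3 : `|k - 1| < e3 by apply: (lt_le_trans k1); rewrite /eta !ge_min lexx orbT.
have Hk : H k < 0.
  by have := e3P k k1e3; rewrite [H 1]/(_ * _) nmulr_lgt0.
have cfk : continuous (fun t => f.[X k t, Y k t]) by apply: continuous_bipoly.
have [|||t t_in ft] := @IVT R (fun t => f.[X k t, Y k t]) (- t0) t0 0.
- lra.
- exact: continuous_subspaceT.
- exact: opposite_signs.
exists (X k t, Y k t); split => //.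
  by rewrite sqdXY k2 divfK // gt_eqF.
apply: e2P => //; rewrite ltr_norml; move: t_in; rewrite in_itv /= => /andP[tl tr].
by rewrite (lt_le_trans _ tl) ?ltrN2 // (le_lt_trans tr).
Qed.

End Descent.

(** * Cells visited by a curve *)

Section Cells.
Variables (R : realType) (d : nat) (f : {poly {poly R}}).
Hypotheses (d_gt0 : (0 < d)%N) (irr_f : irreducible_elt f) (deg_f : bideg_le d f).
Hypotheses (not_line : ~ real_line (on_curve f)) (not_circle : ~ real_circle (on_curve f)).
Local Notation K := (K_of d).
Local Notation C := (on_curve f).
Implicit Types (p q : R * R) (z : (R * R) * (R * R)).

Definition same_distance p p' z : Prop := [/\ C z.1, C z.2 & sqd z.1 p = sqd z.2 p'].

(** The pairs at distance at most that of z0 form a compact set: the first coordinates are confined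
    by the strips and the second ones by the distance. *)
Lemma lowest_point p p' (x1 x2 y1 y2 : R) z0 :
  same_distance p p' z0 -> x1 <= z0.1.1 <= x2 -> y1 <= z0.2.1 <= y2 ->
  exists z, [/\ same_distance p p' z, x1 <= z.1.1 <= x2, y1 <= z.2.1 <= y2 &
    forall z', same_distance p p' z' -> x1 <= z'.1.1 <= x2 -> y1 <= z'.2.1 <= y2 ->
      sqd z.1 p <= sqd z'.1 p].
Proof.
move=> sd0 z0x z0y; pose rho := sqd z0.1 p.
have c11 : continuous (fun z : (R * R) * (R * R) => z.1.1).
  by move=> z; apply: continuous_comp; exact: cvg_fst.
have c12 : continuous (fun z : (R * R) * (R * R) => z.1.2).
  by move=> z; apply: continuous_comp; [exact: cvg_fst|exact: cvg_snd].
have c21 : continuous (fun z : (R * R) * (R * R) => z.2.1).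
  by move=> z; apply: continuous_comp; [exact: cvg_snd|exact: cvg_fst].
have c22 : continuous (fun z : (R * R) * (R * R) => z.2.2).
  by move=> z; apply: continuous_comp; exact: cvg_snd.
have csq (h : (R * R) * (R * R) -> R) (e : R) : continuous h -> continuous (fun z => (h z - e) ^+ 2).
  move=> ch; under eq_fun do rewrite expr2.
  by apply: continuous_mul; apply: continuous_add => //; exact: continuous_const.
have cs1 : continuous (fun z : (R * R) * (R * R) => sqd z.1 p).
  by apply: continuous_add; exact: csq.
have cs2 : continuous (fun z : (R * R) * (R * R) => sqd z.2 p').
  by apply: continuous_add; exact: csq.
have cdiff : continuous (fun z : (R * R) * (R * R) => sqd z.1 p - sqd z.2 p').
  by apply: continuous_add => //; exact: continuous_opp.
have cf1 := continuous_bipoly (p := f) c11 c12.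
have cf2 := continuous_bipoly (p := f) c21 c22.
have closed_pre (h : (R * R) * (R * R) -> R) (D : set R) : continuous h -> closed D -> closed (h @^-1` D)%classic.
  by move=> /continuous_closedP; apply.
pose box := ((`[x1, x2] `*` `[p.2 - (rho + 1), p.2 + (rho + 1)]) `*`
  (`[y1, y2] `*` `[p'.2 - (rho + 1), p'.2 + (rho + 1)]))%classic.
have cbox : compact box by do !apply: compact_setX; exact: segment_compact.
pose level := ((fun z : (R * R) * (R * R) => f.[z.1.1, z.1.2]) @^-1` [set x | x = 0%R] `&`
  (fun z : (R * R) * (R * R) => f.[z.2.1, z.2.2]) @^-1` [set x | x = 0%R] `&`
  (fun z : (R * R) * (R * R) => sqd z.1 p - sqd z.2 p') @^-1` [set x | x = 0%R] `&`
  (fun z : (R * R) * (R * R) => sqd z.1 p) @^-1` [set x | x <= rho])%classic.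
have clevel : closed level.
  by do !apply: closedI; apply: closed_pre => //; try exact: closed_eq; exact: closed_le.
have cA : compact (box `&` level)%classic.
  apply: compact_closedI => //.
have in_box z : same_distance p p' z -> x1 <= z.1.1 <= x2 -> y1 <= z.2.1 <= y2 ->
    sqd z.1 p <= rho -> (box `&` level)%classic z.
  move=> [Cz1 Cz2 zE] zx zy zr.
  have bound (u v : R * R) : sqd u v <= rho -> v.2 - (rho + 1) <= u.2 <= v.2 + (rho + 1).
    rewrite /sqd => h; have := sqr_ge0 (u.1 - v.1) => h1.
    have rho0 : 0 <= rho by exact: sqd_ge0.
    by apply/andP; split; nra.
  split; last by split => //=; split => //=; rewrite zE subrr.
  by split; split; rewrite /= in_itv //=; apply: bound; rewrite -?zE.
have [z] := compact_EVT_min (ex_intro _ z0 (in_box z0 sd0 z0x z0y (lexx _))) cA (continuous_subspaceT cs1).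
rewrite inE => -[[[/= zx _] [/= zy _]] [[[/= Cz1 Cz2] /subr0_eq zE] zr]] zmin.
rewrite in_itv /= in zx; rewrite in_itv /= in zy.
exists z; split=> //.
move=> z' sd' z'x z'y; have [le_rho|gt_rho] := leP (sqd z'.1 p) rho.
  by apply: zmin; rewrite inE; exact: in_box.
by apply: (le_trans zr); exact: ltW.
Qed.

Definition critical p q : Prop := cross (grad f q) (q - p) = 0.

(** Take the lowest pair; if none of the four alternatives held, both of its points could descend by
    the same amount. *)
Lemma cell_witness p p' (x1 x2 y1 y2 : R) z0 :
  same_distance p p' z0 -> x1 <= z0.1.1 <= x2 -> y1 <= z0.2.1 <= y2 ->
  exists z, [/\ same_distance p p' z, x1 <= z.1.1 <= x2, y1 <= z.2.1 <= y2 &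
    [\/ (z.1.1 = x1 \/ z.1.1 = x2), (z.2.1 = y1 \/ z.2.1 = y2),
        critical p z.1 | critical p' z.2]].
Proof.
move=> sd0 z0x z0y; have [[q q'] [[/= Cq Cq' E] zx zy zmin]] := lowest_point sd0 z0x z0y.
exists (q, q'); split=> //=.
have [|bx] := pselect (q.1 = x1 \/ q.1 = x2); first by constructor 1.
have [|by_] := pselect (q'.1 = y1 \/ q'.1 = y2); first by constructor 2.
have [|cq] := pselect (critical p q); first by constructor 3.
have [|cq'] := pselect (critical p' q'); first by constructor 4.
have strict (x u v : R) : u <= x <= v -> ~ (x = u \/ x = v) -> u < x < v.
  move=> /andP[ux xv] ne; rewrite !lt_neqAle ux xv !andbT; apply/andP; split.
    by apply/eqP => e; apply: ne; left.
  by apply/eqP => e; apply: ne; right.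
have [e1 e1_gt0 e1P] := descent Cq cq (strict _ _ _ zx bx).
have [e2 e2_gt0 e2P] := descent Cq' cq' (strict _ _ _ zy by_).
pose e := Num.min e1 e2 / 2.
have m_gt0 : 0 < Num.min e1 e2 by rewrite lt_min e1_gt0.
have [e_gt0 e_lt] : 0 < e /\ e < Num.min e1 e2 by rewrite /e; split; lra.
have /andP[ee1 ee2] : (e < e1) && (e < e2) by rewrite -lt_min.
have [||u [Cu uE ux]] := e1P (sqd q p - e); [lra|lra|].
have [||u' [Cu' u'E u'x]] := e2P (sqd q' p' - e); [lra|lra|].
have := zmin (u, u'); rewrite /= uE => le.
have : sqd q p <= sqd q p - e.
  apply: le; first by split=> //=; rewrite uE u'E E.
    by case/andP: ux => *; apply/andP; split; exact: ltW.
  by case/andP: u'x => *; apply/andP; split; exact: ltW.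
by move=> h; exfalso; lra.
Qed.

Lemma critical_covered p : ~ (exists k, spin_poly f p = k * f) ->
  covered K (fun q => C q /\ critical p q).
Proof.
move=> np; have [|//|cov] := bezout irr_f deg_f (bideg_spin_poly deg_f p); first lia.
by apply: covered_sub cov => // q [Cq cq]; split=> //; rewrite /on_curve spin_polyE.
Qed.

(** A cell is determined by any of its points, so it is enough to bound the witnesses of
    [cell_witness]. One point of a witness lies on one of 2 r vertical lines, or is critical; the
    other point then lies on a known circle. *)
Lemma visited_cells_covered r (lo hi : 'I_r -> R) p p' :
  (forall i j x, lo i <= x <= hi i -> lo j <= x <= hi j -> i = j) ->
  ~ (exists k, spin_poly f p = k * f) -> ~ (exists k, spin_poly f p' = k * f) ->
  covered (4 * r * (K * K) + 2 * (K * K)) (fun ij : 'I_r * 'I_r =>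
    exists z, [/\ same_distance p p' z, lo ij.1 <= z.1.1 <= hi ij.1 & lo ij.2 <= z.2.1 <= hi ij.2]).
Proof.
move=> disj np np'.
have circ o (rho : R) : covered K (fun q => C q /\ sqd q o = rho).
  exact: (circle_covered d_gt0 irr_f deg_f not_circle).
pose ends x := exists i, x = lo i \/ x = hi i.
have ends_cov : covered (2 * r) ends.
  exists (codom lo ++ codom hi); split.
    by rewrite size_cat !size_codom card_ord; lia.
  move=> x [i [->|->]]; rewrite mem_cat; apply/orP; [left|right];
    exact: codom_f.
have vert x : ends x -> covered K (fun q => C q /\ q.1 = x).
  move=> _; have v0 : ((0, 1) : R * R) <> 0 by case=> /eqP; rewrite oner_eq0.
  apply: covered_sub (line_covered d_gt0 irr_f deg_f not_line (x, 0) v0) => // q [Cq qx].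
  by split=> //; rewrite /cross /= qx; ring.
have onends : covered (2 * r * K) (fun q => C q /\ ends q.1).
  apply: covered_sub (covered_image snd (covered_pair ends_cov vert)) => // q [Cq eq].
  by exists (q.1, q).
have swap k (Q : (R * R) * (R * R) -> Prop) : covered k Q -> covered k (fun z => Q (z.2, z.1)).
  move/(covered_image (fun z => (z.2, z.1))); apply: covered_sub => // -[a b] /= Qz.
  by exists (b, a).
have fst_side (Q : R * R -> Prop) k o o' : covered k Q ->
    covered (k * K) (fun z => Q z.1 /\ C z.2 /\ sqd z.1 o = sqd z.2 o').
  move=> cov; apply: covered_sub (covered_pair cov (fun q _ => circ o' (sqd q o))) => //.
  by move=> z [Qz [Cz zE]].
have T1 := fst_side _ _ p p' onends.
have T2 := swap _ _ (fst_side _ _ p' p onends).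
have T3 := fst_side _ _ p p' (critical_covered np).
have T4 := swap _ _ (fst_side _ _ p' p (critical_covered np')).
have W := covered_or (covered_or T1 T2) (covered_or T3 T4).
pose rel (z : (R * R) * (R * R)) (ij : 'I_r * 'I_r) :=
  lo ij.1 <= z.1.1 <= hi ij.1 /\ lo ij.2 <= z.2.1 <= hi ij.2.
have rel_fun z ij ij' : rel z ij -> rel z ij' -> ij = ij'.
  case: ij ij' => [i j] [i' j'] [/= h1 h2] [/= h1' h2'].
  by congr (_, _); [exact: disj h1 h1' | exact: disj h2 h2'].
apply: covered_sub (covered_functional rel_fun W) => //; first by lia.
move=> [i j] [z0 [sd0 z0x z0y]].
have [z [[Cz1 Cz2 zE] zx zy wit]] := cell_witness sd0 z0x z0y.
exists z => //=; case: wit => [b1|b2|c1|c2].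
- by left; left; split=> //; split=> //; exists i.
- by left; right; split; [split=> //; exists j|split].
- by right; left.
- by right; right.
Qed.

End Cells.

(** * Counting incidences *)

Lemma sqdC (R : realType) (p q : R * R) : sqd p q = sqd q p.
Proof. by rewrite /sqd; ring. Qed.

Section Count.
Variables (R : realType) (d : nat) (f : {poly {poly R}}).
Hypotheses (d_gt0 : (0 < d)%N) (irr_f : irreducible_elt f) (deg_f : bideg_le d f).
Hypotheses (not_line : ~ real_line (on_curve f)) (not_circle : ~ real_circle (on_curve f)).
Local Notation K := (K_of d).
Local Notation C := (on_curve f).

Lemma K_gt0 : (0 < K)%N.
Proof. by have := K_ge d_gt0; lia. Qed.

(** The N points pt x serve both as the centres and as the coordinates of the grid points: inc says
    that the curve with centres ij passes through the grid point w. *)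
Section GoodPoints.
Hypothesis many : ~ covered (K + K) C.
Variables (T : finType) (pt : T -> R * R).
Hypotheses (pt_inj : injective pt) (ptC : forall x, C (pt x)).
Hypothesis not_isotropic : forall x, ~ isotropic_point f (pt x).
Hypothesis not_spin : forall x, ~ (exists k, spin_poly f (pt x) = k * f).
Hypothesis not_normal : forall x y, x != y -> ~ double_normal f (pt x) (pt y).
Local Notation N := #|T|.

Let inc (ij w : T * T) : bool := sqd (pt ij.1) (pt w.1) == sqd (pt ij.2) (pt w.2).
Let sym (w : T * T) : bool := `[< symmetric_pair f (pt w.1) (pt w.2) >].

Lemma circle_card t (rho : R) : (#|[set j | rho == sqd (pt j) (pt t)]| <= K)%N.
Proof.
apply: card_covered (circle_covered d_gt0 irr_f deg_f not_circle (pt t) rho).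
  by move=> x y _ _; exact: pt_inj.
by move=> x; rewrite inE => /eqP.
Qed.

(** There are at most 2 K N symmetric grid points, and each lies on at most K N curves: the
    first centre determines the circle about pt w.2 that contains the second one. *)
Lemma symmetric_incidences :
  (\sum_(ij : T * T) #|[set w | inc ij w && sym w]| <= N ^ 2 * (2 * (K * K)))%N.
Proof.
rewrite exchange_count.
apply: (@leq_trans (\sum_(w | sym w) (N * K))).
  apply: leq_sum => w _.
  by apply: (@card_pairs_le _ _ (fun i j => sqd (pt i) (pt w.1) == sqd (pt j) (pt w.2))) => i; exact: circle_card.
rewrite sum_nat_const; apply: (@leq_trans ((N * (K + K)) * (N * K))); last by apply: eq_leq; ring.
rewrite leq_mul2r; apply/orP; right.
have := @card_pairs_le T T (fun s t => sym (s, t)) (K + K).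
rewrite (_ : #|[set z : T * T | sym (z.1, z.2)]| = #|sym|); last first.
  by apply: eq_card => -[s t]; rewrite !inE.
apply=> s; apply: card_covered (symmetric_covered d_gt0 irr_f deg_f not_line not_circle (ptC s)).
  by move=> x y _ _; exact: pt_inj.
by move=> t; rewrite inE => /asboolP.
Qed.

(** The grid points are cut into cells by blocks of l consecutive first coordinates. *)
Lemma asymmetric_incidences l : (0 < l)%N ->
  (\sum_(ij : T * T) #|[set w | inc ij w && ~~ sym w]| <=
    N ^ 2 * (4 * (N %/ l).+1 * (K * K) + 2 * (K * K)) + N ^ 2 * (l * K) ^ 2 * (K * K))%N.
Proof.
move=> l0; pose X t := (pt t).1.
have mult v : (#|[set t | X t == v]| <= K)%N.
  have v0 : ((0, 1) : R * R) <> 0 by case=> /eqP; rewrite oner_eq0.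
  apply: card_covered (line_covered d_gt0 irr_f deg_f not_line (v, 0) v0).
    by move=> x y _ _; exact: pt_inj.
  move=> x; rewrite inE => /eqP xv; split; first exact: ptC.
  by rewrite /cross /=; rewrite /X in xv; rewrite xv; ring.
have [beta [lo [hi [inside disj block]]]] := strips l0 mult.
have cardTT : (#|{: T * T}| = N ^ 2)%N by rewrite card_prod mulnn.
rewrite -cardTT; apply: (incidence_bound (beta := fun w : T * T => (beta w.1, beta w.2))).
- move=> [i j].
  have cov := visited_cells_covered d_gt0 irr_f deg_f not_line not_circle disj
    (@not_spin i) (@not_spin j).
  apply: (card_covered (h := id)) cov; first by move=> ? ? _ _.
  move=> _ /imsetP[[s t] /[!inE] /andP[/eqP /= st _] ->].
  exists (pt s, pt t); split=> //; last exact: inside; last exact: inside.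
  by split=> //=; rewrite sqdC st sqdC.
- move=> [s t] [s' t'] neq.
  have [ss|ns] := boolP (sym (s, t)).
    by rewrite eq_card0 // => ij; rewrite finset.in_set andbF.
  have [ss'|ns'] := boolP (sym (s', t')).
    by rewrite eq_card0 // => ij; rewrite finset.in_set !andbF.
  have neq' : (pt s, pt t) <> (pt s', pt t').
    by case=> /pt_inj ss' /pt_inj tt'; case/eqP: neq; rewrite ss' tt'.
  have ndn : ~ (pt s <> pt s' /\ double_normal f (pt s) (pt s')).
    by case=> ne; apply: not_normal; apply/eqP => E; apply: ne; rewrite E.
  have cov := equidistant_covered d_gt0 irr_f deg_f not_line not_circle many (ptC s) (ptC s')
    (@not_isotropic t) (@not_isotropic t') (elimN (asboolP _) ns) (elimN (asboolP _) ns') ndn neq'.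
  apply: (card_covered (h := fun ij : T * T => (pt ij.1, pt ij.2))) cov.
    by move=> [i j] [i' j'] _ _ [/pt_inj -> /pt_inj ->].
  move=> [i j]; rewrite !inE /inc /= => /andP[/andP[/eqP h _] /andP[/eqP h' _]].
  by split; rewrite //=; exact: ptC.
- move=> [s t]; rewrite -mulnn.
  apply: (@leq_trans (#|[set t' | beta t' == beta s]| * #|[set t' | beta t' == beta t]|)).
    rewrite -cardsX; apply: subset_leq_card; apply/fintype.subsetP => -[u v].
    by rewrite !inE xpair_eqE.
  by apply: leq_mul; exact: block.
Qed.

Lemma good_points_bound (values : seq R) :
  (forall x y, sqd (pt x) (pt y) \in values) ->
  (N ^ 4 <= (37 * K ^ 4) ^ 3 * size values ^ 3)%N.
Proof.
move=> inv; have [N0|N_gt0] := posnP N; first by rewrite N0 exp0n.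
have [l lP] := cube_root_floor N.
have l0 : (0 < l)%N by case: (l) lP => //; rewrite exp1n; lia.
apply: (balance K_gt0 N_gt0 lP).
have := coincidences_bound (F := fun z : T * T => sqd (pt z.1) (pt z.2)) (values := values) (fun z => inv z.1 z.2).
rewrite card_prod mulnn -mulnn => /leq_trans; apply; rewrite leq_mul2l; apply/orP; right.
have -> : #|[set z : (T * T) * (T * T) | sqd (pt z.1.1) (pt z.1.2) == sqd (pt z.2.1) (pt z.2.2)]| =
   (\sum_(ij : T * T) #|[set w | inc ij w]|)%N.
  under eq_bigr do rewrite -sum1dep_card.
  rewrite pair_big_dep /= sum1dep_card.
  rewrite -(card_imset _ (f := fun z : (T * T) * (T * T) => ((z.1.1, z.2.1), (z.1.2, z.2.2)))); last first.
    by move=> [[a b] [a' b']] [[c e] [c' e']] [-> -> -> ->].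
  apply: eq_card => -[[i j] [s t]]; rewrite !inE /inc /=; apply/idP/imsetP.
    by move=> E; exists ((i, s), (j, t)); rewrite ?inE.
  by move=> [[[a b] [a' b']]]; rewrite inE /= => E [-> -> -> ->].
apply: leq_trans (leq_add symmetric_incidences (asymmetric_incidences l0)).
rewrite -big_split /=; apply: leq_sum => ij _.
by rewrite -(cardsID [set w | sym w]); apply: leq_add;
  apply: subset_leq_card; apply/fintype.subsetP => w; rewrite !inE // andbC.
Qed.

End GoodPoints.

(** The first summand covers sets of at most 4 K + 2 points; the second one accounts for the loss of
    points when the exceptional ones are removed and a graph of degree K is made independent. *)
Definition count_const : nat := (4 * K + 2) ^ 4 + (2 * K.+1) ^ 4 * (37 * K ^ 4) ^ 3.

(** Singular points, isotropic points and the centre for which all of C is critical are removed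
    first; they are few ([singular_covered], [isotropic_covered], [spin_center_covered]). A chord
    is normal at a regular end only if it lies on the normal line there, so the graph of the
    chords that are normal at both ends has bounded degree and a large independent set. *)
Lemma curve_points_bound (T : finType) (pt : T -> R * R) (values : seq R) :
  injective pt -> (forall x, C (pt x)) -> (0 < size values)%N ->
  (forall x y, sqd (pt x) (pt y) \in values) ->
  (#|T| ^ 4 <= count_const * size values ^ 3)%N.
Proof.
move=> pt_inj ptC v0 inv.
have v30 : (0 < size values ^ 3)%N by rewrite expn_gt0 v0.
have [small|large] := leqP #|T| (4 * K + 2).
  apply: (@leq_trans ((4 * K + 2) ^ 4)); first by rewrite leq_exp2r.
  by rewrite (leq_trans _ (leq_mul (leq_addr _ _) (leqnn _))) // leq_pmulr.
have inj_in (A : {set T}) : {in A &, injective pt} by move=> x y _ _; exact: pt_inj.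
have many : ~ covered (K + K) C.
  move=> cov; have := card_covered (inj_in [set: T]%SET) (fun x _ => ptC x) cov.
  by rewrite cardsT => h; move: (leq_trans large h); lia.
pose bad q := (C q /\ grad f q = 0) \/ (isotropic_point f q \/ exists k, spin_poly f q = k * f).
have bad_cov : covered (K + (K + 1)) bad.
  apply: covered_or; first exact: singular_covered deg_f many.
  apply: covered_or; first exact: isotropic_covered deg_f many.
  exact: (spin_center_covered d_gt0 irr_f deg_f not_line many).
pose A := [set x | ~~ `[< bad (pt x) >]].
have cardA : (#|T| <= #|A| + (K + (K + 1)))%N.
  rewrite -(cardsC A) leq_add2l; apply: card_covered bad_cov; first exact: inj_in.
  by move=> x; rewrite !inE negbK => /asboolP.
pose e x y := (x != y) && `[< double_normal f (pt x) (pt y) >].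
have e_sym : ssrbool.symmetric e.
  move=> x y; rewrite /e eq_sym; congr (_ && _).
  by apply/asboolP/asboolP => -[h1 h2].
have e_irr : irreflexive e by move=> x; rewrite /e eqxx.
have e_deg x : x \in A -> (#|[set y in A | e x y]| <= K)%N.
  rewrite inE => /asboolP nbad.
  have g0 : grad f (pt x) <> 0 by move=> g0; apply: nbad; left.
  apply: card_covered (line_covered d_gt0 irr_f deg_f not_line (pt x) g0); first exact: inj_in.
  by move=> y; rewrite !inE => /andP[_ /andP[_ /asboolP[h _]]].
have [S [SA Sind cardS]] := independent_set e_sym e_irr e_deg.
pose T' := {x : T | x \in S}; pose pt' (x : T') := pt (val x).
have goodS (x : T') : ~ bad (pt' x).
  by have /(fintype.subsetP SA) := valP x; rewrite inE => /asboolP.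
have := @good_points_bound many T' pt' _ _ _ _ _ values.
have -> : #|{: T'}| = #|S| by rewrite card_sig; apply: eq_card => x; rewrite inE.
move=> bound.
have {bound} : (#|S| ^ 4 <= (37 * K ^ 4) ^ 3 * size values ^ 3)%N.
  apply: bound.
  - by move=> x y /pt_inj /val_inj.
  - by move=> x; exact: ptC.
  - by move=> x h; apply: (goodS x); right; left.
  - by move=> x h; apply: (goodS x); right; right.
  - move=> x y xy dn; have := Sind _ _ (valP x) (valP y).
    by rewrite /e (inj_eq val_inj) xy /= => /asboolP; apply.
  - by move=> x y; exact: inv.
move=> bound; apply: (@leq_trans ((2 * K.+1 * #|S|) ^ 4)).
  by rewrite leq_exp2r //; move: large cardA cardS; move: #|T| #|A| #|S| => t a s; lia.
rewrite expnMn /count_const mulnDl (leq_trans _ (leq_addl _ _)) // -mulnA leq_mul2l.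
by rewrite bound orbT.
Qed.

End Count.

(** * From pairs of reals to points of the plane *)

Section Rows.
Variable R : realType.
Implicit Types (a b x : 'rV[R]_2).

Definition row_pair x : R * R := (x 0 ord0, x 0 (lift ord0 ord0)).
Definition pair_row (q : R * R) : 'rV[R]_2 := \row_i (if i == ord0 then q.1 else q.2).

Lemma row_pairK : cancel row_pair pair_row.
Proof.
move=> x; apply/rowP => i; rewrite mxE /row_pair /=; case: eqP => [->//|/eqP ni].
by congr (x _ _); apply/val_inj; case: i ni => [[|[|]]].
Qed.

Lemma pair_rowK : cancel pair_row row_pair.
Proof. by move=> [u v]; rewrite /row_pair !mxE. Qed.

Lemma edistE a b : Defs.edist a b = Num.sqrt (sqd (row_pair a) (row_pair b)).
Proof. by rewrite /Defs.edist big_ord_recl big_ord1. Qed.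

Lemma zero_locusE (f : {mpoly R[2]}) x :
  zero_locus f x <-> on_curve (bipoly_of f) (row_pair x).
Proof. by rewrite /zero_locus /= meval_bipoly_of. Qed.

Lemma real_line_is_line (f : {mpoly R[2]}) :
  real_line (on_curve (bipoly_of f)) -> is_line (zero_locus f).
Proof.
move=> [p [v [v0 fE]]]; exists (pair_row p), (pair_row v); split.
  by apply/eqP => E; apply: v0; rewrite -[v]pair_rowK E /row_pair !mxE.
have alongE t : pair_row p + t *: pair_row v = pair_row (along p v t).
  by apply/rowP => i; rewrite !mxE; case: (i == ord0).
apply/seteqP; split=> x.
  by move=> /zero_locusE /fE [t E] /=; exists t; rewrite alongE -E row_pairK.
by move=> [t ->]; apply/zero_locusE; rewrite alongE pair_rowK; apply/fE; exists t.
Qed.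

Lemma real_circle_is_circle (f : {mpoly R[2]}) :
  real_circle (on_curve (bipoly_of f)) -> is_circle (zero_locus f).
Proof.
move=> [o [r [r0 fE]]]; exists (pair_row o), (Num.sqrt r); split; first by rewrite sqrtr_gt0.
apply/seteqP; split=> x.
  by move=> /zero_locusE /fE E /=; rewrite edistE pair_rowK E.
rewrite /= edistE pair_rowK => E; apply/zero_locusE/fE.
have := congr1 (fun u => u ^+ 2) E.
by rewrite /= !sqr_sqrtr // ?sqd_ge0 // ltW.
Qed.

End Rows.

(** Coincidences are counted with squared distances and include the distance 0, whence the
    successor. *)
Lemma distinct_distances_bound (R : realType) (d : nat) (C : set 'rV[R]_2)
    (P : {fset 'rV[R]_2}) :
  (0 < d)%N -> irreducible_curve_of_degree_le d C -> ~ is_line C -> ~ is_circle C ->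
  (forall p, p \in P -> C p) ->
  (#|` P| ^ 4 <= count_const d * #|` distinct_distances P|.+1 ^ 3)%N.
Proof.
move=> d_gt0 [f [irr_f deg_f ->]] nline ncirc PC.
pose values : seq R := 0 :: [seq y ^+ 2 | y <- distinct_distances P].
pose pt (x : P) := row_pair (val x).
have -> : #|` distinct_distances P|.+1 = size values by rewrite /= size_map.
rewrite cardfE; apply: (@curve_points_bound R d (bipoly_of f)) => //.
- exact: irreducible_bipoly_of.
- exact: bideg_bipoly_of.
- by move/real_line_is_line.
- by move/real_circle_is_circle.
- by move=> x y /(can_inj (@row_pairK R)); exact: val_inj.
- by move=> x; apply/zero_locusE/PC/valP.
move=> x y; rewrite inE; have [->|xy] := eqVneq x y.
  by rewrite /sqd !subrr expr0n addr0 eqxx.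
apply/orP; right; apply/mapP; exists (Defs.edist (val x) (val y)).
  apply/imfsetP; exists (val x, val y) => //=.
  by rewrite !inE /= !fsvalP /= (inj_eq val_inj).
by rewrite edistE sqr_sqrtr // sqd_ge0.
Qed.

Theorem mainTheorem6 (R : realType) (eps : R) (d : nat)
    (eps_gt0 : 0 < eps) (d_gt0 : (0 < d)%N) :
  exists c : R, 0 < c /\
    forall (C : set 'rV[R]_2) (P : {fset 'rV[R]_2}) (n : nat),
      irreducible_curve_of_degree_le d C ->
      ~ is_line C -> ~ is_circle C ->
      (forall p : 'rV[R]_2, p \in P -> C p) ->
      #|` P| = n -> (2 <= n)%N ->
      c * n%:R `^ (4%:R / 3%:R - eps) <= #|` distinct_distances P|%:R.
Proof.
pose Q : R := (8 * count_const d)%:R.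
have Q_gt0 : 0 < Q.
  rewrite ltr0n muln_gt0 /= /count_const addn_gt0 expn_gt0.
  by apply/orP; left; apply/orP; left; lia.
exists (Q `^ 3^-1)^-1; split; first by rewrite invr_gt0 powR_gt0.
move=> C P n irrC nline ncirc PC cardP n_ge2.
have := distinct_distances_bound d_gt0 irrC nline ncirc PC; rewrite cardP.
set D := #|` distinct_distances P| => bound.
have D_gt0 : (0 < D)%N.
  have [x [y [xP yP xy]]] : exists x y, [/\ x \in P, y \in P & x != y].
    have P0 : (0 < #|` P|)%N by rewrite cardP; lia.
    move: P0; rewrite cardfs_gt0 => /fset0Pn[x xP].
    have : (0 < #|` P `\ x|)%fset%N by have := cardfsD1 x P; rewrite xP cardP; lia.
    rewrite cardfs_gt0 => /fset0Pn[y]; rewrite !inE => /andP[yx yP].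
    by exists x, y; rewrite eq_sym.
  rewrite cardfs_gt0; apply/fset0Pn; exists (Defs.edist x y).
  by apply/imfsetP; exists (x, y) => //=; rewrite !inE /= xP yP xy.
have n4 : n%:R ^+ 4 <= Q * D%:R ^+ 3 :> R.
  rewrite -!natrX -natrM ler_nat (leq_trans bound) // mulnAC -[(8 * _)%N]/(2 ^ 3 * _)%N -expnMn.
  by rewrite [leqRHS]mulnC leq_mul2l leq_exp2r //; apply/orP; right; lia.
have n_ge1 : 1 <= n%:R :> R by rewrite ler1n; lia.
have third (x : R) k : 0 <= x -> (x ^+ k) `^ 3^-1 = x `^ (k%:R / 3).
  by move=> x0; rewrite -powR_mulrn // -powRrM.
rewrite mulrC ler_pdivrMr ?powR_gt0 //.
apply: (@le_trans _ _ (n%:R `^ (4%:R / 3))).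
  by rewrite ler_powR // lerBlDr lerDl ltW.
rewrite -third ?ler0n //; apply: (@le_trans _ _ ((Q * D%:R ^+ 3) `^ 3^-1)).
  by apply: ge0_ler_powR; rewrite ?nnegrE ?invr_ge0 ?exprn_ge0 ?mulr_ge0 ?ler0n // ltW.
rewrite powRM; [|exact: ltW|by rewrite exprn_ge0 ?ler0n].
by rewrite third ?ler0n // divff ?pnatr_eq0 // powRr1 ?ler0n // mulrC.
Qed.
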